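(* Let $\Phi_i$ $(i=1,\ldots,n_1)$, $\overline{\Phi}_i$ $(i=1,\ldots,n_2)$, $\Psi_i$ $(i=1,\ldots,n_3)$, $\overline{\Psi}_i$ $(i=1,\ldots,n_4)$ be positive linear mappings on $\mathbb{B}(\mathscr{H})$ such that $\sum_{i=1}^{n_1}\Phi_i(I)=\alpha I$, $\sum_{i=1}^{n_2}\overline{\Phi}_i(I)=\delta I$, $\sum_{i=1}^{n_3}\Psi_i(I)=\gamma I$, $\sum_{i=1}^{n_4}\overline{\Psi}_i(I)=\beta I$ for some real numbers $\alpha,\beta,\gamma,\delta>0$. Let $J$ be an interval and let $A_i$ $(i=1,\ldots,n_1)$, $D_i$ $(i=1,\ldots,n_2)$, $C_i$ $(i=1,\ldots,n_3)$ and $B_i$ $(i=1,\ldots,n_4)$ be operators in $\sigma(J)$ such that, for all indices, $A_i\leq m\leq B_i$, $m\leq C_i$, $B_i\leq M\leq D_i$ and $C_i\leq M$ for two real numbers $m<M$. If $$\frac1\alpha\sum_{i=1}^{n_1}\Phi_i(A_i)+\frac1\delta\sum_{i=1}^{n_2}\overline{\Phi}_i(D_i)=\frac1\gamma\sum_{i=1}^{n_3}\Psi_i(C_i)+\frac1\beta\sum_{i=1}^{n_4}\overline{\Psi}_i(B_i),$$ then for every continuous convex function $f:J\to\mathbb{R}$ $$\begin{aligned} f\left(\frac1\gamma\sum_{i=1}^{n_3}\Psi_i(C_i)\right)+f\left(\frac1\beta\sum_{i=1}^{n_4}\overline{\Psi}_i(B_i)\right)&\leq \frac1\alpha\sum_{i=1}^{n_1}\Phi_i(f(A_i))+\frac1\delta\sum_{i=1}^{n_2}\overline{\Phi}_i(f(D_i))-\delta_f\widetilde{X}\\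 &\leq \frac1\alpha\sum_{i=1}^{n_1}\Phi_i(f(A_i))+\frac1\delta\sum_{i=1}^{n_2}\overline{\Phi}_i(f(D_i)),\end{aligned}$$ where $\delta_f=f(m)+f(M)-2f\left(\frac{m+M}{2}\right)$ and $$\widetilde{X}=1-\frac{1}{M-m}\left(\left|\frac1\beta\sum_{i=1}^{n_4}\overline{\Psi}_i(B_i)-\frac{m+M}{2}\right|+\left|\frac1\gamma\sum_{i=1}^{n_3}\Psi_i(C_i)-\frac{m+M}{2}\right|\right).$$ If $f$ is continuous and concave on $J$, then the reverse inequalities hold.
   Context: $\mathscr{H}$ is a complex Hilbert space, $\mathbb{B}(\mathscr{H})$ the $C^*$-algebra of bounded linear operators on it, $I$ the identity. $\sigma(J)$ denotes the set of all self-adjoint operators on $\mathscr{H}$ with spectra contained in $J$. The order $\leq$ on self-adjoint operators is the usual one ($S\leq T$ iff $T-S$ is positive semidefinite); a scalar in an operator inequality or expression stands for that scalar times $I$. $f(T)$ is defined by continuous functional calculus and $|T|=(T^2)^{1/2}$. A linear map on $\mathbb{B}(\mathscr{H})$ is positive if it maps positive operators to positive operators. The scalar $\delta$ (normalizing the maps $\overline{\Phi}_i$) is unrelated to $\delta_f$. *)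

(* Defs.v *)
From HB Require Import structures.
From mathcomp Require Import all_boot all_order all_algebra.
From mathcomp Require Import sesquilinear complex.
From mathcomp Require Import all_classical all_reals.
From mathcomp Require Import topology normedtype sequences convex.

Set Implicit Arguments.
Unset Strict Implicit.
Unset Printing Implicit Defensive.

Import Order.TTheory GRing.Theory Num.Theory.
Import numFieldNormedType.Exports.
Local Open Scope classical_set_scope.
Local Open Scope ring_scope.
Local Open Scope complex_scope.

HB.mixin Record CompleteNormedModule_isHilbert (R : realType) H
    & CompleteNormedModule R[i] H := {
  hdot : {dot H for Num.conj} ;
  hdotxx : forall x : H, hdot x x = `|x| ^+ 2 }.

#[short(type="hilbertType")]
HB.structure Definition Hilbert (R : realType) :=
  { H of CompleteNormedModule R[i] H & CompleteNormedModule_isHilbert R H }.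

Section BoundedOperators.
Variables (R : realType) (H : hilbertType R).

Definition bounded_linear : {pred H -> H} :=
  [pred f : H -> H |
    `[< linear f /\ exists M : R, forall x, `|f x| <= M%:C * `|x| >]].

Fact bounded_linear_submod : GRing.submod_closed bounded_linear.
Proof.
split=> [|a f g /asboolP[lf [M bM]] /asboolP[lg [N bN]]]; apply/asboolP; split.
- by move=> a x y; rewrite scaler0 addr0.
- by exists 0 => x; rewrite normr0 mul0r.
- move=> b x y; rewrite !fctE lf lg.
  by rewrite !scalerDr !scalerA (mulrC a) addrACA.
- exists (complex.Re `|a| * M + N) => x; rewrite !fctE.
  have -> : (complex.Re `|a| * M + N)%:C = `|a| * M%:C + N%:C.
    by rewrite -[in RHS](RRe_real (normr_real a)) -rmorphM -rmorphD.
  rewrite (le_trans (ler_normD _ _))// normrZ mulrDl lerD ?bN// -mulrA.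
  by rewrite ler_wpM2l.
Qed.

HB.instance Definition _ := GRing.isSubmodClosed.Build R[i] (H -> H)
  bounded_linear bounded_linear_submod.

Record bop := Bop {
  bop_fun :> H -> H ;
  bop_boundedP : bop_fun \in bounded_linear }.

HB.instance Definition _ := [isSub for bop_fun].
HB.instance Definition _ := [Choice of bop by <:].
HB.instance Definition _ := [SubChoice_isSubLmodule of bop by <:].

Implicit Types S T : bop.

Fact bop_one_subproof : idfun \in bounded_linear.
Proof.
by apply/asboolP; split=> //; exists 1 => x; rewrite mul1r.
Qed.

Fact bop_mul_subproof S T : S \o T \in bounded_linear.
Proof.
have /asboolP[lS [M bM]] := bop_boundedP S.
have /asboolP[lT [N bN]] := bop_boundedP T.
apply/asboolP; split=> [a x y|]; first by rewrite /= lT lS.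
exists (`|M| * N) => x /=; rewrite (le_trans (bM _))//.
have -> : (`|M| * N)%:C = `|M|%:C * N%:C by rewrite -rmorphM.
rewrite -mulrA.
apply: (@le_trans _ _ (`|M|%:C * `|T x|)).
  by rewrite ler_wpM2r// lecR ler_norm.
by rewrite ler_wpM2l ?bN// lecR.
Qed.

Definition bop_one : bop := Bop bop_one_subproof.
Definition bop_mul S T : bop := Bop (bop_mul_subproof S T).

Fact bop_mulA : associative bop_mul. Proof. by move=> S T U; apply: val_inj. Qed.
Fact bop_mul1 : left_id bop_one bop_mul. Proof. by move=> T; apply: val_inj. Qed.
Fact bop_mulr1 : right_id bop_one bop_mul. Proof. by move=> T; apply: val_inj. Qed.
Fact bop_mulDl : left_distributive bop_mul +%R.
Proof. by move=> S T U; apply: val_inj. Qed.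
Fact bop_mulDr : right_distributive bop_mul +%R.
Proof.
move=> S T U; apply: val_inj; apply/funext => x /=.
have /asboolP[lS _] := bop_boundedP S.
by have := lS 1 (T x) (U x); rewrite !scale1r.
Qed.

HB.instance Definition _ := GRing.Zmodule_isPzRing.Build bop
  bop_mulA bop_mul1 bop_mulr1 bop_mulDl bop_mulDr.

Definition is_adjoint T S := forall x y : H, hdot (T x) y = hdot x (S y).
Definition selfadjoint T := is_adjoint T T.

(* In complex order, [0 <= z] includes that [z] is real. *)
Definition op_ge0 T := forall x : H, 0 <= hdot (T x) x.
Definition op_le S T := op_ge0 (T - S).

Definition op_invertible T := exists S, S * T = 1 /\ T * S = 1.
Definition spectrum T : set R[i] := [set z | ~ op_invertible (T - z *: (1 : bop))].

(* Usually written sigma(J); not the spectrum of an operator. *)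
Definition selfadjoint_in (J : set R) : set bop :=
  [set T | selfadjoint T /\ spectrum T `<=` [set t%:C | t in J]].

Definition opnorm T : R := sup [set complex.Re `|T x| | x in [set x | `|x| <= 1]].

Definition op_horner (p : {poly R}) T : bop :=
  \sum_(i < size p) (p`_i)%:C *: T ^+ i.

(* Continuous functional calculus of a self-adjoint operator: [f(T)] is the
   limit in operator norm of [p_n(T)] for real polynomials [p_n] converging to
   [f] uniformly on the spectrum. [S] is uniquely determined for self-adjoint
   [T] by the identity [opnorm p(T) = sup_(t in spectrum T) |p(t)|], and exists
   when [f] is continuous on the spectrum; otherwise [cfc f T] is arbitrary. *)
Definition is_cfc (f : R -> R) T S :=
  exists p : nat -> {poly R},
    {uniform [set t : R | spectrum T t%:C], (fun n t => (p n).[t]) @ \oo --> f}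
    /\ (opnorm (S - op_horner (p n) T) @[n --> \oo] --> (0 : R)).
Definition cfc (f : R -> R) T : bop := xget 0 [set S | is_cfc f T S].

Definition op_abs T : bop := cfc Num.sqrt (T ^+ 2).

Definition positive_map (Phi : bop -> bop) :=
  forall T, op_ge0 T -> op_ge0 (Phi T).

End BoundedOperators.

Arguments bop {R} H.
Arguments selfadjoint_in {R H} J.

Notation "S '<=op' T" := (op_le S T) (at level 70, no associativity) : ring_scope.

(* A real number standing for the corresponding multiple of the identity. *)
Definition op_scalar {R : realType} (H : hilbertType R) (a : R) : bop H :=
  a%:C *: (1 : bop H).
Arguments op_scalar {R H} a.

(* Multiplication of an operator by a real number. *)
Definition op_rscale {R : realType} {H : hilbertType R} (a : R) (T : bop H) :
  bop H := a%:C *: T.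
Notation "a '*op' T" := (op_rscale a T) (at level 40, left associativity)
  : ring_scope.

Definition concave_function (R : numFieldType) (E : lmodType R)
    (D : set (convex_lmodType E)) (f : convex_lmodType E -> R^o) :=
  convex_function D (fun x => - f x).

Definition delta_f {R : realType} (f : R -> R) (m M : R) : R :=
  f m + f M - 2 * f ((m + M) / 2).

Definition X_tilde {R : realType} {H : hilbertType R} (m M : R)
    (S T : bop H) : bop H :=
  1 - (M - m)^-1 *op (op_abs (S - op_scalar ((m + M) / 2))
                      + op_abs (T - op_scalar ((m + M) / 2))).

(* Main.v *)
Require Import Defs.
From mathcomp Require Import all_boot all_order all_algebra.
From mathcomp Require Import sesquilinear complex ring lra.
From mathcomp Require Import all_classical all_reals interval_inference.
From mathcomp Require Import topology normedtype sequences realfun convex.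

Set Implicit Arguments.
Unset Strict Implicit.
Unset Printing Implicit Defensive.

Import Order.TTheory GRing.Theory Num.Theory.
Import numFieldNormedType.Exports.
Local Open Scope classical_set_scope.
Local Open Scope ring_scope.
Local Open Scope complex_scope.

(** Let [k t + c] be the chord of the convex function [f] over [[m, M]]. Outside
    [[m, M]] the chord lies below [f]. Inside, [f] lies below the chord, and even
    below the two half-chords through the midpoint, which amounts to subtracting
    from the chord [delta_f] times the tent [1/2 - |t - (m + M)/2| / (M - m)].
    These are the scalar facts [chord_le_outside] and [refined_chord].

    The functional calculus turns them into operator inequalities. The spectra of
    the [A i] and the [D i] are outside the open interval, so the average of
    [f(A i)] dominates [k] times the average of the [A i] plus [c], and the same
    holds for [D]. The averages [CC] of the [C i] and [BB] of the [B i] are between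
    [m] and [M], so [f(CC)] and [f(BB)] are below the refined chord at [CC] and
    [BB]. By the balance hypothesis the affine parts of the four inequalities have
    the same sum on both sides, and what remains is the first inequality. The
    second holds because [delta_f] and the tents are nonnegative. A concave [f] is
    treated by replacing [f] with [- f].

    The analytic content is thus the calculus of a self-adjoint operator [T]: if
    [f >= 0] on the spectrum of [T] then [f(T) >= 0] ([is_cfc_ge0]), and [f(T)]
    exists for continuous [f] ([cfc_spec]). Positivity is proved for polynomials
    first ([op_horner_ge0]): the infimum of the numerical range of [p(T)] belongs to
    its spectrum ([inf_spectrum]), and the spectrum of [p(T)] is the image under [p]
    of that of [T], since [p] minus a constant splits over the complex numbers.
    Spectra are real and lie between the bounds of the numerical range
    ([spec_real], [spec_ge]) because coercive operators are invertible, by the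
    Neumann series ([coercive_invertible]). Existence of [f(T)] follows from the
    Weierstrass theorem ([weierstrass], with Bernstein polynomials) and the
    completeness of the space of bounded operators ([bop_complete]).

    If [H] is zero every operator is nonnegative; otherwise a nonzero vector [x0] is
    available, and spectra are nonempty. *)

(** * Real-valued norm and inner product; bounded operators *)

Section RealStructure.
Variables (R : realType) (H : hilbertType R).
Implicit Types (x y z : H) (S T V : bop H) (a b c : R).

(** The order of the real numbers is used throughout, so the norm and the inner
    product, both valued in [R[i]], are replaced by their real parts. No
    information is lost: see [normE] and [Im_hdot]. *)
Definition nrm x : R := complex.Re `|x|.
Definition rdot x y : R := complex.Re (hdot x y).

Lemma normE x : `|x| = (nrm x)%:C.
Proof. by rewrite /nrm (RRe_real (normr_real x)). Qed.

Lemma nrm_ge0 x : 0 <= nrm x.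
Proof. by rewrite -ler0c -normE. Qed.

Lemma nrm0 : nrm 0 = 0. Proof. by rewrite /nrm normr0. Qed.

Lemma nrm_eq0 x : (nrm x == 0) = (x == 0).
Proof. by rewrite -(normr_eq0 x) normE -(inj_eq (@complexI R)). Qed.

Lemma nrm_gt0 x : (0 < nrm x) = (x != 0).
Proof. by rewrite lt_def nrm_eq0 nrm_ge0 andbT. Qed.

Lemma nrmD x y : nrm (x + y) <= nrm x + nrm y.
Proof. by rewrite -lecR rmorphD /= -!normE ler_normD. Qed.

Lemma nrmN x : nrm (- x) = nrm x. Proof. by rewrite /nrm normrN. Qed.

Lemma nrmB x y : nrm (x - y) <= nrm x + nrm y.
Proof. by rewrite -(nrmN y) nrmD. Qed.

Lemma nrmZ a x : nrm (a%:C *: x) = `|a| * nrm x.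
Proof.
apply: (@complexI R); rewrite rmorphM /= -!normE normrZ; congr (_ * _).
by rewrite normc_def /= expr0n addr0 sqrtr_sqr.
Qed.

Lemma hdotC x y : hdot x y = (hdot y x)^*%C.
Proof. by have := hermC (@hdot R H) x y; rewrite /= expr0 mul1r. Qed.

Lemma rdotC x y : rdot x y = rdot y x.
Proof. by rewrite /rdot hdotC; case: (hdot y x). Qed.

Lemma rdotDl x y z : rdot (x + y) z = rdot x z + rdot y z.
Proof. by rewrite /rdot linearDl raddfD. Qed.

Lemma rdotZl a x y : rdot (a%:C *: x) y = a * rdot x y.
Proof.
rewrite /rdot linearZl_LR /=; case: (hdot x y) => u v /=.
by rewrite mul0r subr0.
Qed.

Lemma rdotNl x y : rdot (- x) y = - rdot x y.
Proof. by rewrite /rdot linearNl raddfN. Qed.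

Lemma rdotBl x y z : rdot (x - y) z = rdot x z - rdot y z.
Proof. by rewrite rdotDl rdotNl. Qed.

Lemma rdotBr x y z : rdot x (y - z) = rdot x y - rdot x z.
Proof. by rewrite ![rdot x _]rdotC rdotBl. Qed.

Lemma rdotZr a x y : rdot x (a%:C *: y) = a * rdot x y.
Proof. by rewrite ![rdot x _]rdotC rdotZl. Qed.

Lemma rdotxx x : rdot x x = nrm x ^+ 2.
Proof. by rewrite /rdot hdotxx normE -rmorphXn. Qed.

Lemma hdot_self x : hdot x x = (nrm x ^+ 2)%:C.
Proof. by rewrite hdotxx normE -rmorphXn. Qed.

(** The imaginary part is itself a real inner product, so bounds on [rdot]
    control all of [hdot]. *)
Lemma Im_hdot x y : complex.Im (hdot x y) = rdot (- 'i *: x) y.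
Proof.
rewrite /rdot linearZl_LR /=; case: (hdot x y) => u v /=.
by rewrite oppr0 mul0r sub0r mulN1r opprK.
Qed.

Lemma nrmNiZ x : nrm (- 'i *: x) = nrm x.
Proof.
apply: (@complexI R); rewrite -!normE normrZ normrN normc_def /=.
by rewrite expr0n expr1n add0r sqrtr1 mul1r.
Qed.

Lemma rdot_le x y : rdot x y <= nrm x * nrm y.
Proof.
have [->|y0] := eqVneq y 0.
  by rewrite rdotC /rdot linear0l nrm0 mulr0.
have [->|x0] := eqVneq x 0; first by rewrite /rdot linear0l nrm0 mul0r.
pose w := (nrm y)%:C *: x - (nrm x)%:C *: y.
have : 0 <= rdot w w by rewrite rdotxx sqr_ge0.
rewrite /w rdotBl !rdotBr !rdotZl !rdotZr !rdotxx (rdotC y x).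
have : 0 < nrm x * nrm y by rewrite mulr_gt0 ?nrm_gt0.
set s := rdot x y; set u := nrm x; set v := nrm y => uv0 h.
rewrite -(ler_pM2l uv0).
lra.
Qed.

Lemma rdot_norm_le x y : `|rdot x y| <= nrm x * nrm y.
Proof. by rewrite ler_norml rdot_le lerNl -rdotNl -(nrmN x) rdot_le. Qed.

Lemma opD S T x : (S + T) x = S x + T x. Proof. by []. Qed.
Lemma opN T x : (- T) x = - T x. Proof. by []. Qed.
Lemma opM S T x : (S * T) x = S (T x). Proof. by []. Qed.
Lemma op1 x : (1 : bop H) x = x. Proof. by []. Qed.
Lemma op0 x : (0 : bop H) x = 0. Proof. by []. Qed.
Lemma opZ (k : R[i]) T x : (k *: T) x = k *: T x. Proof. by []. Qed.
Definition opE := (opD, opN, opM, op1, op0, opZ).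

Lemma bopP S T : (forall x, S x = T x) -> S = T.
Proof. by move=> ST; apply: val_inj; apply/funext. Qed.

Lemma bop_lin T (k : R[i]) x y : T (k *: x + y) = k *: T x + T y.
Proof. by have /asboolP[lT _] := bop_boundedP T; rewrite lT. Qed.

Lemma bopD T x y : T (x + y) = T x + T y.
Proof. by have := bop_lin T 1 x y; rewrite !scale1r. Qed.

Lemma bop0 T : T 0 = 0.
Proof. by apply: (addrI (T 0)); rewrite -bopD !addr0. Qed.

Lemma bopZ T (k : R[i]) x : T (k *: x) = k *: T x.
Proof. by have := bop_lin T k x 0; rewrite !addr0 bop0 addr0. Qed.

Lemma bopN T x : T (- x) = - T x.
Proof. by rewrite -scaleN1r bopZ scaleN1r. Qed.

Lemma bopB T x y : T (x - y) = T x - T y.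
Proof. by rewrite bopD bopN. Qed.

Lemma op_scaleAl (k : R[i]) S T : (k *: S) * T = k *: (S * T).
Proof. exact: bopP. Qed.

Lemma op_scaleAr (k : R[i]) S T : S * (k *: T) = k *: (S * T).
Proof. by apply: bopP => x; rewrite !opE bopZ. Qed.

Definition bounded_by T c := forall x, nrm (T x) <= c * nrm x.

Lemma bounded_by_le T a b : a <= b -> bounded_by T a -> bounded_by T b.
Proof. by move=> ab Ta x; apply: le_trans (Ta x) _; rewrite ler_wpM2r ?nrm_ge0. Qed.

Lemma bop_bounded T : exists2 K, 0 < K & bounded_by T K.
Proof.
have /asboolP[_ [M bM]] := bop_boundedP T.
exists (`|M| + 1); first by rewrite ltr_wpDl.
move=> x; apply: (@le_trans _ _ (M * nrm x)).
  by rewrite -lecR rmorphM /= -!normE bM.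
by rewrite ler_wpM2r ?nrm_ge0// (le_trans (ler_norm M))// lerDl.
Qed.

Lemma bounded_byD S T a b : bounded_by S a -> bounded_by T b -> bounded_by (S + T) (a + b).
Proof.
by move=> Sa Tb x; rewrite opE (le_trans (nrmD _ _))// mulrDl lerD.
Qed.

Lemma bounded_byN T a : bounded_by T a -> bounded_by (- T) a.
Proof. by move=> Ta x; rewrite opE nrmN. Qed.

Lemma bounded_byZ a T b : bounded_by T b -> bounded_by (a%:C *: T) (`|a| * b).
Proof. by move=> Tb x; rewrite opE nrmZ -mulrA ler_wpM2l. Qed.

Lemma bounded_byM S T a b : 0 <= a -> bounded_by S a -> bounded_by T b ->
  bounded_by (S * T) (a * b).
Proof.
move=> a0 Sa Tb x; rewrite opE (le_trans (Sa _))// -mulrA ler_wpM2l//.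
Qed.

Lemma bounded_by1 : bounded_by 1 1.
Proof. by move=> x; rewrite mul1r. Qed.

(** With [opnorm_le], this trades every statement about [opnorm] for one about
    bounds, which compose without suprema. *)
Lemma bounded_by_opnorm T : bounded_by T (opnorm T).
Proof.
move=> x; have [->|x0] := eqVneq x 0; first by rewrite bop0 nrm0 mulr0.
have nx0 : 0 < nrm x by rewrite nrm_gt0.
rewrite -ler_pdivrMr//; apply: ub_le_sup.
  have [K K0 TK] := bop_bounded T; exists K => _ [y /= y1 <-].
  apply: le_trans (TK y) _; rewrite ler_piMr ?(ltW K0)//.
  by rewrite -lecR -normE.
exists ((nrm x)^-1%:C *: x).
  by rewrite /= normE nrmZ gtr0_norm ?invr_gt0// mulVf ?gt_eqF// lexx.
by rewrite bopZ -/(nrm _) nrmZ ger0_norm ?invr_ge0 ?ltW// mulrC.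
Qed.

Lemma opnorm_le T c : 0 <= c -> bounded_by T c -> opnorm T <= c.
Proof.
move=> c0 Tc; apply: ge_sup; first by exists (nrm (T 0)); exists 0 => //=; rewrite normr0.
move=> _ [y /= y1 <-]; apply: le_trans (Tc y) _.
by rewrite ler_piMr// -lecR -normE.
Qed.

Lemma opnorm_ge0 T : 0 <= opnorm T.
Proof.
apply: ub_le_sup; last by exists 0; rewrite /= ?normr0// bop0 normr0.
have [K K0 TK] := bop_bounded T; exists K => _ [y /= y1 <-].
apply: le_trans (TK y) _; rewrite ler_piMr ?(ltW K0)//.
by rewrite -lecR -normE.
Qed.

(** Completeness, freed from the filters and the complex radii. *)
Lemma hcauchy_cvg (u : nat -> H) :
  (forall e, 0 < e -> exists N, forall n k, (N <= n)%N -> (N <= k)%N ->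
     nrm (u n - u k) <= e) ->
  exists l, forall e, 0 < e -> exists N, forall n, (N <= n)%N -> nrm (u n - l) <= e.
Proof.
move=> cu.
have : cvg (u @ \oo).
  apply/cauchy_cvgP/cauchy_exP => eps eps0.
  have epsE : eps = (complex.Re eps)%:C by rewrite RRe_real// gtr0_real.
  have e0 : 0 < complex.Re eps / 2 by rewrite divr_gt0// -ltcR -epsE.
  have [N uN] := cu _ e0.
  exists (u N); exists N => // n /= Nn.
  rewrite -ball_normE /ball_ /= normE epsE ltcR.
  rewrite (le_lt_trans (uN _ _ (leqnn N) Nn))//.
  by move: e0; set w := complex.Re eps => e0; lra.
move=> /cvg_ex[l ul]; exists l => e e0.
have /cvgrPdist_le := ul => /(_ e%:C).
rewrite ltcR => /(_ e0)[N _ NP]; exists N => n /NP /=.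
by rewrite distrC normE lecR.
Qed.

End RealStructure.

(** * Completeness and invertibility *)

Section Invertibility.
Variables (R : realType) (H : hilbertType R).
Implicit Types (x y : H) (S T V W : bop H) (a b c e : R).

Lemma nrmZc (k : R[i]) x : nrm (k *: x) = complex.Re `|k| * nrm x.
Proof.
apply: (@complexI R); rewrite rmorphM /= -!normE normrZ.
by rewrite (RRe_real (normr_real k)).
Qed.

Lemma nrm_le0 x : (forall e, 0 < e -> nrm x <= e) -> x = 0.
Proof.
move=> h; apply/eqP; rewrite -nrm_eq0 eq_le nrm_ge0 andbT.
by apply/ler_addgt0Pr => e e0; rewrite add0r; apply: h.
Qed.

Lemma bounded_by_eq0 T : (forall e, 0 < e -> bounded_by T e) -> T = 0.
Proof.
move=> h; apply: bopP => x; apply: nrm_le0 => e e0; rewrite /=.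
have d0 : 0 < nrm x + 1 by rewrite ltr_wpDl ?nrm_ge0.
have := h (e / (nrm x + 1)) (divr_gt0 e0 d0) x => /le_trans; apply.
rewrite mulrAC ler_pdivrMr// ler_wpM2l ?(ltW e0)// lerDl//.
Qed.

(** The limit exists pointwise by completeness of [H] and is linear as such; it
    is bounded, and approached in norm, because the estimate is uniform on balls. *)
Lemma bop_complete (T : nat -> bop H) :
  (forall e, 0 < e -> exists N, forall n k, (N <= n)%N -> (N <= k)%N ->
     bounded_by (T n - T k) e) ->
  exists S, forall e, 0 < e -> exists N, forall n, (N <= n)%N -> bounded_by (T n - S) e.
Proof.
move=> cT.
have cTx x : exists l, forall e, 0 < e -> exists N, forall n, (N <= n)%N ->
    nrm (T n x - l) <= e.
  apply: hcauchy_cvg => e e0.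
  have d0 : 0 < nrm x + 1 by rewrite ltr_wpDl ?nrm_ge0.
  have [N NP] := cT (e / (nrm x + 1)) (divr_gt0 e0 d0).
  exists N => n k Nn Nk; have := NP n k Nn Nk x; rewrite !opE => /le_trans; apply.
  rewrite mulrAC ler_pdivrMr// ler_wpM2l ?(ltW e0)// lerDl//.
have [l lP] := choice cTx.
have close e : 0 < e -> exists N, forall n, (N <= n)%N ->
    forall x, nrm (T n x - l x) <= e * nrm x.
  move=> e0; have [N NP] := cT e e0; exists N => n Nn x.
  apply/ler_addgt0Pr => d d0; have [N' N'P] := lP x d d0.
  have -> : T n x - l x = (T n x - T (maxn N N') x) + (T (maxn N N') x - l x).
    by rewrite addrA subrK.
  rewrite (le_trans (nrmD _ _))// lerD//; last by rewrite N'P// leq_maxr.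
  exact: NP n _ Nn (leq_maxl _ _) x.
have lin_l : linear l.
  move=> k x y; apply/eqP; rewrite -subr_eq0; apply/eqP; apply: nrm_le0 => e e0.
  pose d := complex.Re `|k| + 1 + 1.
  have k0 : 0 <= complex.Re `|k| by rewrite -ler0c (RRe_real (normr_real k)).
  have d0 : 0 < d by rewrite /d; lra.
  have ed0 : 0 < e / d by rewrite divr_gt0.
  have [N1 P1] := lP x _ ed0; have [N2 P2] := lP y _ ed0.
  have [N3 P3] := lP (k *: x + y) _ ed0.
  pose N := maxn N1 (maxn N2 N3).
  have {}P1 := P1 N (leq_maxl _ _).
  have {}P2 := P2 N (leq_trans (leq_maxl _ _) (leq_maxr _ _)).
  have {}P3 := P3 N (leq_trans (leq_maxr _ _) (leq_maxr _ _)).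
  have -> : l (k *: x + y) - (k *: l x + l y) =
      k *: (T N x - l x) + (T N y - l y) - (T N (k *: x + y) - l (k *: x + y)).
    by rewrite bop_lin scalerBr addrACA -opprD opprB [RHS]addrC addrA subrK.
  rewrite (le_trans (nrmB _ _))// (le_trans (lerD (nrmD _ _) (lexx _)))// nrmZc.
  have -> : e = complex.Re `|k| * (e / d) + e / d + e / d.
    by rewrite /d; field; rewrite gt_eqF.
  by rewrite !lerD// ler_wpM2l.
have [N0 N0P] := close 1 ltr01.
have bl : l \in @bounded_linear R H.
  apply/asboolP; split=> //.
  have [K K0 KP] := bop_bounded (T N0); exists (K + 1) => x.
  rewrite !normE -rmorphM lecR.
  have -> : l x = T N0 x - (T N0 x - l x) by rewrite opprB addrC subrK.
  by rewrite (le_trans (nrmB _ _))// mulrDl lerD// N0P.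
exists (Bop bl) => e e0; have [N NP] := close e e0.
by exists N => n Nn x; apply: NP.
Qed.

Lemma op_invertible_sandwich S V1 V2 : V1 * S = 1 -> S * V2 = 1 -> op_invertible S.
Proof.
move=> h1 h2; exists V2; split=> //.
by have -> : V2 = V1 by rewrite -[V1]mulr1 -h2 mulrA h1 mul1r.
Qed.

(** A factor of an invertible product has a one-sided inverse for free;
    commutation supplies the other side. *)
Lemma op_invertible_comm S T : S * T = T * S -> op_invertible (S * T) -> op_invertible S.
Proof.
move=> ST [V [h1 h2]]; apply: (@op_invertible_sandwich _ (V * T) (T * V)).
  by rewrite -mulrA -ST.
by rewrite mulrA.
Qed.

Lemma op_invertibleM S T : op_invertible S -> op_invertible T -> op_invertible (S * T).
Proof.
move=> [V [V1 V2]] [W [W1 W2]]; exists (W * V); split.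
  by rewrite mulrA -(mulrA W) V1 mulr1.
by rewrite mulrA -(mulrA S) W2 mulr1.
Qed.

Lemma op_invertibleZ (k : R[i]) S : k != 0 -> op_invertible S -> op_invertible (k *: S).
Proof.
move=> k0 [V [h1 h2]]; exists (k^-1 *: V).
by rewrite !op_scaleAl !op_scaleAr h1 h2 !scalerA divff// mulVf// scale1r.
Qed.

Lemma bounded_byX T a n : 0 <= a -> bounded_by T a -> bounded_by (T ^+ n) (a ^+ n).
Proof.
move=> a0 Ta; elim: n => [|n IH]; first exact: bounded_by1.
by rewrite !exprS; apply: bounded_byM.
Qed.

Lemma exprn_small a e : 0 <= a < 1 -> 0 < e -> exists N, forall n, (N <= n)%N -> a ^+ n <= e.
Proof.
move=> /andP[a0 a1] e0.
have /cvg_expr/cvgrPdist_le/(_ e e0)[N _ NP] : `|a| < 1 by rewrite ger0_norm.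
exists N => n /NP /=; rewrite sub0r normrN ger0_norm// exprn_ge0//.
Qed.

(** The Neumann series [\sum_i W ^+ i] converges to the inverse. *)
Lemma neumann W r : 0 <= r < 1 -> bounded_by W r -> op_invertible (1 - W).
Proof.
move=> r01 Wr; have /andP[r0 r1] := r01.
have d0 : 0 < 1 - r by rewrite subr_gt0.
have below x : nrm x <= (1 - r)^-1 * nrm ((1 - W) x).
  rewrite mulrC ler_pdivlMr// mulrC mulrBl mul1r lerBlDr (le_trans _ (lerD (lexx _) (Wr x)))//.
  by rewrite !opE (le_trans _ (nrmD _ _))// subrK.
pose V n : bop H := \sum_(i < n) W ^+ i.
have VE n : (1 - W) * V n = 1 - W ^+ n.
  by rewrite -[1 - W]opprB -[1 - _ ^+ _]opprB subrX1 mulNr.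
(* Partial sums are compared through [(1 - W) * V n = 1 - W ^+ n], as [1 - W] is
   bounded below. *)
have [Vl Vlim] : exists S, forall e, 0 < e ->
    exists N, forall n, (N <= n)%N -> bounded_by (V n - S) e.
  apply: bop_complete => e e0.
  have e'0 : 0 < e * (1 - r) / 2 by rewrite divr_gt0 ?mulr_gt0.
  have [N NP] := exprn_small r01 e'0.
  exists N => n k Nn Nk x; rewrite (le_trans (below _))// -opM mulrBr !VE.
  rewrite mulrC ler_pdivrMr//.
  have -> : 1 - W ^+ n - (1 - W ^+ k) = W ^+ k - W ^+ n.
    by rewrite opprB addrC addrA subrK.
  have := bounded_byD (bounded_byX k r0 Wr) (bounded_byN (bounded_byX n r0 Wr)).
  move=> /(_ x)/le_trans; apply.
  rewrite mulrAC ler_wpM2r ?nrm_ge0//.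
  by have := NP _ Nn; have := NP _ Nk; lra.
have right_inv : (1 - W) * Vl = 1.
  apply/eqP; rewrite -subr_eq0; apply/eqP; apply: bounded_by_eq0 => e e0.
  have [K K0 KP] := bop_bounded (1 - W).
  have e1 : 0 < e / 2 by rewrite divr_gt0.
  have e2 : 0 < e / 2 / K by rewrite divr_gt0.
  have [N1 P1] := exprn_small r01 e1; have [N2 P2] := Vlim _ e2.
  pose N := maxn N1 N2.
  have -> : (1 - W) * Vl - 1 = - ((1 - W) * (V N - Vl)) + - W ^+ N.
    by rewrite mulrBr VE opprB -addrA -opprD subrK.
  apply: bounded_by_le (bounded_byD (bounded_byN (bounded_byM (ltW K0) KP (P2 N (leq_maxr _ _))))
                      (bounded_byN (bounded_byX N r0 Wr))).
  have -> : K * (e / 2 / K) = e / 2 by field; rewrite gt_eqF.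
  by have := P1 N (leq_maxl _ _); lra.
exists Vl; split=> //.
apply/eqP; rewrite -subr_eq0; apply/eqP.
apply: bopP => x; apply/eqP; rewrite -nrm_eq0 eq_le nrm_ge0 andbT.
apply: le_trans (below _) _.
by rewrite -opM mulrBr mulrA right_inv mul1r mulr1 subrr op0 nrm0 mulr0.
Qed.

(** The Lax-Milgram theorem: for a small [t > 0] the operator
    [1 - t S] is a strict contraction, so [t S = 1 - (1 - t S)] is inverted by
    its Neumann series. Coercivity concerns real parts only, and this form of it
    is shared by imaginary multiples of [T - z] when [z] is not real. *)
Lemma coercive_invertible S c : 0 < c ->
  (forall x, c * nrm x ^+ 2 <= rdot (S x) x) -> op_invertible S.
Proof.
move=> c0 Sc; have [K0 K00 KP0] := bop_bounded S.
(* Enlarging the bound by [c] makes [c / K] less than 1. *)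
pose K := K0 + c; have KP : bounded_by S K by apply: bounded_by_le KP0; rewrite lerDl ltW.
have cK : c < K by rewrite ltrDr.
have Kp : 0 < K by apply: lt_trans cK.
(* The minimizer of [1 - 2 t c + t ^ 2 K ^ 2]. *)
pose t := c / K ^+ 2; have t0 : 0 < t by rewrite divr_gt0// exprn_gt0.
pose s := c / K; have s0 : 0 < s by rewrite divr_gt0.
have s1 : s < 1 by rewrite ltr_pdivrMr// mul1r.
have Wb : bounded_by (1 - t%:C *: S) (1 - s ^+ 2 / 2).
  move=> x; rewrite -(@ler_pXn2r _ 2) ?nnegrE ?nrm_ge0 ?mulr_ge0 ?nrm_ge0//; last first.
    by rewrite subr_ge0 ler_pdivrMr//; nra.
  rewrite -rdotxx !opE rdotBl !rdotBr !rdotZl !rdotZr !rdotxx (rdotC x).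
  have h1 := Sc x.
  have h2 : nrm (S x) ^+ 2 <= K ^+ 2 * nrm x ^+ 2.
    by rewrite -exprMn ler_pXn2r ?nnegrE ?nrm_ge0 ?mulr_ge0 ?nrm_ge0 ?(ltW Kp).
  have h3 : t * (c * nrm x ^+ 2) <= t * rdot (S x) x by rewrite ler_wpM2l ?(ltW t0).
  have h4 : t * (t * nrm (S x) ^+ 2) <= t * (t * (K ^+ 2 * nrm x ^+ 2)).
    by rewrite !ler_wpM2l ?(ltW t0).
  have e1 : t * (c * nrm x ^+ 2) = s ^+ 2 * nrm x ^+ 2.
    by rewrite /t /s; field; rewrite gt_eqF.
  have e2 : t * (t * (K ^+ 2 * nrm x ^+ 2)) = s ^+ 2 * nrm x ^+ 2.
    by rewrite /t /s; field; rewrite gt_eqF.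
  rewrite exprMn; rewrite e1 in h3; rewrite e2 in h4.
  have : 0 <= (s ^+ 2 / 2) ^+ 2 * nrm x ^+ 2 by rewrite mulr_ge0 ?sqr_ge0.
  by lra.
have := neumann _ Wb; rewrite subKr => inv.
have : op_invertible (t%:C^-1 *: (t%:C *: S)).
  apply: op_invertibleZ; first by
    rewrite invr_eq0 -(rmorph0 (real_complex R)) (inj_eq (@complexI R)) gt_eqF.
  apply: inv; apply/andP; split; nra.
rewrite scalerA mulVf ?scale1r//.
by rewrite -(rmorph0 (real_complex R)) (inj_eq (@complexI R)) gt_eqF.
Qed.

End Invertibility.

(** * Self-adjoint operators and their spectra *)

Section SelfAdjoint.
Variables (R : realType) (H : hilbertType R).
Implicit Types (x y : H) (S T : bop H) (a b c : R) (z : R[i]).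

Lemma sa_rdot T x y : selfadjoint T -> rdot (T x) y = rdot x (T y).
Proof. by move=> sT; rewrite /rdot sT. Qed.

Lemma sa_Im T x : selfadjoint T -> complex.Im (hdot (T x) x) = 0.
Proof.
move=> sT; have := sT x x; rewrite [RHS]hdotC; case: (hdot (T x) x) => u v /= [].
by move=> /eqP; rewrite -addr_eq0 -mulr2n mulrn_eq0 => /eqP.
Qed.

Lemma op_ge0P T : selfadjoint T -> op_ge0 T <-> forall x, 0 <= rdot (T x) x.
Proof.
move=> sT; split=> T0 x; have := T0 x; rewrite lecE /rdot /=; first by case/andP.
by move=> ->; rewrite andbT sa_Im.
Qed.

(** Polarization: the defect [d] of symmetry is a sesquilinear form that
    vanishes on the diagonal, and over the complex numbers such a form is zero. *)
Lemma op_ge0_selfadjoint T : op_ge0 T -> selfadjoint T.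
Proof.
move=> T0.
pose d x y := hdot (T x) y - hdot x (T y).
have dD x x' y : d (x + x') y = d x y + d x' y.
  by rewrite /d bopD !linearDl /= opprD addrACA.
have dDr x y y' : d x (y + y') = d x y + d x y'.
  by rewrite /d bopD !linearDr /= opprD addrACA.
have dZ k x y : d (k *: x) y = k * d x y.
  by rewrite /d bopZ !linearZl_LR /= mulrBr.
have dZr k x y : d x (k *: y) = k^* * d x y.
  by rewrite /d bopZ !linearZr_LR /= mulrBr.
have dxx x : d x x = 0.
  rewrite /d [hdot x (T x)]hdotC; have := T0 x; rewrite lecE /=.
  by case: (hdot (T x) x) => u v /= /andP[/eqP -> _]; rewrite oppr0 subrr.
have dxy x y : d x y + d y x = 0.
  by have := dxx (x + y); rewrite dD !dDr !dxx addr0 add0r.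
move=> x y; apply/eqP; rewrite -subr_eq0 -/(d x y); apply/eqP.
have := dxy ('i *: x) y; rewrite dZ dZr /= => h.
have {h} h : d x y - d y x = 0.
  have i0 : ('i : R[i]) != 0 by rewrite eq_complex /= oner_eq0 andbF.
  apply: (mulfI i0); rewrite mulr0 mulrBr -[RHS]h; congr (_ + _).
  by rewrite -mulNr; congr (_ * _); apply/eqP; rewrite eq_complex /= oppr0 !eqxx.
have := dxy x y; have -> : d y x = d x y by apply/eqP; rewrite eq_sym -subr_eq0 h.
by move=> /eqP; rewrite -mulr2n mulrn_eq0 /= => /eqP.
Qed.

Lemma selfadjointD S T : selfadjoint S -> selfadjoint T -> selfadjoint (S + T).
Proof. by move=> sS sT x y; rewrite !opE linearDl linearDr /= sS sT. Qed.

Lemma selfadjointZ a T : selfadjoint T -> selfadjoint (a%:C *: T).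
Proof.
move=> sT x y; rewrite !opE linearZl_LR linearZr_LR /= sT; congr (_ * _).
exact: (esym (conjc_real a)).
Qed.

Lemma selfadjoint1 : selfadjoint (1 : bop H).
Proof. by []. Qed.

Lemma selfadjoint0 : selfadjoint (0 : bop H).
Proof. by move=> x y; rewrite !opE linear0l linear0r. Qed.

Lemma selfadjointN T : selfadjoint T -> selfadjoint (- T).
Proof. by move=> sT x y; rewrite !opE linearNl linearNr /= sT. Qed.

Lemma selfadjointB S T : selfadjoint S -> selfadjoint T -> selfadjoint (S - T).
Proof. by move=> sS sT; apply: selfadjointD => //; apply: selfadjointN. Qed.

Lemma selfadjointX T n : selfadjoint T -> selfadjoint (T ^+ n).
Proof.
move=> sT; elim: n => [|n IH] x y; first exact: selfadjoint1.
by rewrite {1}exprS opM sT IH -opM -exprSr.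
Qed.

Lemma selfadjoint_horner (p : {poly R}) T : selfadjoint T -> selfadjoint (op_horner p T).
Proof.
move=> sT; apply: (big_ind (fun S => selfadjoint S)).
- exact: selfadjoint0.
- exact: selfadjointD.
- by move=> i _; apply/selfadjointZ/selfadjointX.
Qed.

Lemma selfadjoint_scalar a : selfadjoint (op_scalar a : bop H).
Proof. exact/selfadjointZ/selfadjoint1. Qed.

(** The common source of all bounds on the spectrum: [T - z] is invertible as
    soon as some multiple of it is coercive. *)
Lemma spec_coercive T z (u : R[i]) c : u != 0 -> 0 < c ->
  (forall x, c * nrm x ^+ 2 <= rdot (u *: (T x - z *: x)) x) -> ~ spectrum T z.
Proof.
move=> u0 c0 h; apply; have inv : op_invertible (u *: (T - z *: (1 : bop H))).
  by apply: (coercive_invertible c0) => x; apply: le_trans (h x) _; rewrite !opE.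
have := op_invertibleZ (invr_neq0 u0) inv.
by rewrite scalerA mulVf// scale1r.
Qed.

Lemma spec_ge T a t : (forall x, a * nrm x ^+ 2 <= rdot (T x) x) ->
  spectrum T t%:C -> a <= t.
Proof.
move=> Ta; apply: contraPP => /negP; rewrite -ltNge => ta.
apply: (@spec_coercive _ _ 1 (a - t)); rewrite ?oner_neq0 ?subr_gt0// => x.
by rewrite scale1r rdotBl rdotZl rdotxx mulrBl lerD2r.
Qed.

Lemma spec_le T b t : (forall x, rdot (T x) x <= b * nrm x ^+ 2) ->
  spectrum T t%:C -> t <= b.
Proof.
move=> Ta; apply: contraPP => /negP; rewrite -ltNge => ta.
apply: (@spec_coercive _ _ (-1) (t - b)); rewrite ?oppr_eq0 ?oner_neq0 ?subr_gt0// => x.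
by rewrite scaleN1r opprB rdotBl rdotZl rdotxx mulrBl lerD2l lerN2.
Qed.

Lemma spec_real T z : selfadjoint T -> spectrum T z -> z = (complex.Re z)%:C.
Proof.
case: z => s t sT /= Tz; suff -> : t = 0 by [].
apply: contrapT => /eqP t0; move: Tz.
(* After multiplication by the imaginary number [u], the self-adjoint part of
   [T - z] contributes nothing to the real part and [t ^+ 2] remains. *)
pose u : R[i] := 0 +i* t.
have u0 : u != 0 by rewrite eq_complex /= negb_and t0 orbT.
apply: (@spec_coercive _ _ u (t ^+ 2)) => //.
  by rewrite lt_def sqrf_eq0 t0 sqr_ge0.
move=> x; rewrite scalerBr rdotBl.
rewrite scalerA /rdot !linearZl_LR /= hdot_self /=.
have := sa_Im x sT; case: (hdot (T x) x) => p q /= ->.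
rewrite le_eqVlt; apply/orP; left; apply/eqP; ring.
Qed.

(** The infimum [a] of the numerical range is a spectral value. Put
    [P = T - a], which is nonnegative. If [P] had an inverse bounded by [L], then
    [nrm x <= L * nrm (P x)] and [nrm (P x) ^+ 2 <= K * rdot (P x) x] would make
    [P] coercive, and the numerical range would stay away from its infimum. In
    particular the spectrum is nonempty. *)
Lemma inf_spectrum T (x0 : H) : x0 != 0 -> selfadjoint T ->
  exists2 a, spectrum T a%:C & forall x, a * nrm x ^+ 2 <= rdot (T x) x.
Proof.
move=> x00 sT; pose E := [set rdot (T x) x | x in [set x | nrm x = 1]].
have normalize x : x != 0 -> nrm ((nrm x)^-1%:C *: x) = 1.
  rewrite -nrm_gt0 => nx; rewrite nrmZ gtr0_norm ?invr_gt0// mulVf// gt_eqF//.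
have E0 : E !=set0.
  pose y := (nrm x0)^-1%:C *: x0; exists (rdot (T y) y); exists y => //.
  exact: normalize.
have lE : has_lbound E.
  have [K K0 KP] := bop_bounded T; exists (- K) => _ [x /= x1 <-].
  have := rdot_norm_le (T x) x; rewrite ler_norml => /andP[+ _].
  by apply: le_trans; rewrite x1 mulr1 lerN2 (le_trans (KP x))// x1 mulr1.
have aP x : inf E * nrm x ^+ 2 <= rdot (T x) x.
  have [->|nx] := eqVneq x 0; first by rewrite nrm0 expr0n mulr0 bop0 rdotxx nrm0 expr0n.
  have := ge_inf lE (ex_intro2 _ _ ((nrm x)^-1%:C *: x) (normalize x nx) erefl).
  rewrite bopZ rdotZl rdotZr mulrA -expr2 exprVn mulrC ler_pdivlMr//.
  by rewrite exprn_gt0// nrm_gt0.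
exists (inf E) => // - [V [VP _]].
set P := T - _ in VP.
have sP : selfadjoint P by apply: selfadjointB => //; apply: selfadjoint_scalar.
have P0 x : 0 <= rdot (P x) x.
  by rewrite !opE rdotBl rdotZl rdotxx subr_ge0.
have [K K0 KP] := bop_bounded P; have [L L0 LP] := bop_bounded V.
(* [P] is nonnegative at [x - K^-1 P x]. *)
have PP x : nrm (P x) ^+ 2 <= K * rdot (P x) x.
  have := P0 (x - K^-1%:C *: P x).
  rewrite bopB bopZ rdotBl !rdotBr !rdotZl !rdotZr (sa_rdot (P x) x sP) !rdotxx.
  have h : rdot (P (P x)) (P x) <= K * nrm (P x) ^+ 2.
    by rewrite (le_trans (rdot_le _ _))// expr2 mulrA ler_wpM2r ?nrm_ge0.
  have : K^-1 * (K^-1 * rdot (P (P x)) (P x)) <= K^-1 * nrm (P x) ^+ 2.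
    by rewrite ler_pM2l ?invr_gt0// mulrC ler_pdivrMr// mulrC.
  move=> h1 h2; rewrite -ler_pdivrMl//; lra.
pose eta := (K * L ^+ 2)^-1.
have eta0 : 0 < eta by rewrite invr_gt0 mulr_gt0 ?exprn_gt0.
have Peta x : eta * nrm x ^+ 2 <= rdot (P x) x.
  rewrite mulrC ler_pdivrMr ?mulr_gt0 ?exprn_gt0//.
  have -> : nrm x = nrm (V (P x)) by rewrite -opM VP.
  apply: (@le_trans _ _ ((L * nrm (P x)) ^+ 2)).
    by rewrite ler_pXn2r ?nnegrE ?nrm_ge0 ?mulr_ge0 ?nrm_ge0 ?(ltW L0).
  by rewrite exprMn [leRHS]mulrA [leRHS]mulrC ler_wpM2l ?sqr_ge0// mulrC PP.
have : inf E + eta <= inf E; last by rewrite gerDl leNgt eta0.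
apply: lb_le_inf => // _ [x /= x1 <-].
have := Peta x; rewrite !opE rdotBl rdotZl rdotxx x1 expr1n; lra.
Qed.

End SelfAdjoint.

(** * Polynomial and continuous functional calculus *)

Section PolynomialCalculus.
Variables (R : realType) (H : hilbertType R).
Implicit Types (x y : H) (S T : bop H) (a b c : R) (z : R[i]) (q : {poly R[i]})
  (p r : {poly R}).

(** Complex coefficients are needed to split polynomials into linear factors;
    [op_hornerE] relates this to the real calculus [op_horner]. *)
Definition ceval q T : bop H := \sum_(i < size q) q`_i *: T ^+ i.

Lemma ceval_widen q T n : (size q <= n)%N -> ceval q T = \sum_(i < n) q`_i *: T ^+ i.
Proof.
move=> qn; rewrite /ceval (big_ord_widen n (fun i => q`_i *: T ^+ i) qn).
rewrite big_mkcond /=; apply: eq_bigr => i _; case: ltnP => // h.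
by rewrite nth_default// scale0r.
Qed.

Lemma cevalD q1 q2 T : ceval (q1 + q2) T = ceval q1 T + ceval q2 T.
Proof.
pose n := maxn (size (q1 + q2)) (maxn (size q1) (size q2)).
rewrite (@ceval_widen _ _ n) ?leq_maxl// (@ceval_widen q1 _ n); last first.
  by rewrite /n !leq_max leqnn orbT.
rewrite (@ceval_widen q2 _ n); last by rewrite /n !leq_max leqnn !orbT.
by rewrite -big_split; apply: eq_bigr => i _; rewrite coefD scalerDl.
Qed.

Lemma cevalZ z q T : ceval (z *: q) T = z *: ceval q T.
Proof.
rewrite (@ceval_widen _ _ (size q)) ?size_scale_leq// scaler_sumr.
by apply: eq_bigr => i _; rewrite coefZ scalerA.
Qed.

Lemma cevalC z T : ceval z%:P T = z *: (1 : bop H).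
Proof.
by rewrite (@ceval_widen _ _ 1) ?size_polyC_leq1// big_ord1 coefC expr0.
Qed.

Lemma cevalMX q T : ceval (q * 'X) T = ceval q T * T.
Proof.
have hs : (size (q * 'X)%R <= (size q).+1)%N.
  have [->|q0] := eqVneq q 0; first by rewrite mul0r size_poly0.
  by rewrite size_mulX.
rewrite (@ceval_widen _ _ (size q).+1)//.
rewrite big_ord_recl coefMX eqxx scale0r add0r mulr_suml.
apply: eq_bigr => i _; rewrite coefMX /= /bump /= add1n /=.
by rewrite op_scaleAl exprSr.
Qed.

Lemma cevalX T : ceval 'X T = T.
Proof. by rewrite -['X]mul1r cevalMX cevalC scale1r mul1r. Qed.

Lemma cevalM q1 q2 T : ceval (q1 * q2) T = ceval q1 T * ceval q2 T.
Proof.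
elim/poly_ind: q2 => [|q2 c IH].
  by rewrite mulr0 -(rmorph0 polyC) cevalC scale0r mulr0.
rewrite mulrDr mulrA cevalD cevalMX IH [q1 * _]mulrC mul_polyC cevalZ.
by rewrite cevalD cevalMX cevalC mulrDr mulrA op_scaleAr mulr1.
Qed.

Lemma ceval_comp q1 q2 T : ceval (q1 \Po q2) T = ceval q1 (ceval q2 T).
Proof.
elim/poly_ind: q1 => [|q1 c IH].
  by rewrite comp_poly0 -(rmorph0 polyC) !cevalC !scale0r.
by rewrite comp_poly_MXaddC [RHS]cevalD cevalMX [LHS]cevalD [in LHS]cevalM IH !cevalC.
Qed.

Lemma op_hornerE p T : op_horner p T = ceval (map_poly (real_complex R) p) T.
Proof.
rewrite /op_horner /ceval size_map_poly; apply: eq_bigr => i _.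
by rewrite coef_map.
Qed.

Lemma op_hornerD p r T : op_horner (p + r) T = op_horner p T + op_horner r T.
Proof. by rewrite !op_hornerE rmorphD cevalD. Qed.

Lemma op_hornerZ a p T : op_horner (a *: p) T = a%:C *: op_horner p T.
Proof. by rewrite !op_hornerE map_polyZ cevalZ. Qed.

Lemma op_hornerM p r T : op_horner (p * r) T = op_horner p T * op_horner r T.
Proof. by rewrite !op_hornerE rmorphM cevalM. Qed.

Lemma op_hornerC a T : op_horner a%:P T = op_scalar a.
Proof. by rewrite op_hornerE map_polyC cevalC. Qed.

Lemma op_hornerX T : op_horner 'X T = T.
Proof. by rewrite op_hornerE map_polyX cevalX. Qed.

Lemma op_horner_comp p r T : op_horner (p \Po r) T = op_horner p (op_horner r T).
Proof. by rewrite !op_hornerE map_comp_poly ceval_comp. Qed.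

(** Half of the spectral mapping theorem: if every factor [T - z] of [q(T)] is
    invertible, then so is [q(T)]. A spectral value [z0] is required only to
    treat [q = 0]. *)
Lemma spectrum_root_of_ceval q T z0 : spectrum T z0 -> ~ op_invertible (ceval q T) ->
  exists2 z, spectrum T z & root q z.
Proof.
move=> Tz0 ninv; have [q0|q0] := eqVneq q 0; first by exists z0; rewrite ?q0 ?root0.
apply: contrapT => nz; apply: ninv.
have [rs qE] := closed_field_poly_normal q.
have rsT z : z \in rs -> op_invertible (T - z *: (1 : bop H)).
  move=> zrs; apply: contrapT => h; apply: nz; exists z => //.
  by rewrite qE rootZ ?lead_coef_eq0// root_prod_XsubC.
rewrite qE cevalZ; apply: op_invertibleZ; first by rewrite lead_coef_eq0.
elim: rs rsT {qE} => [|z rs IH] rsT.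
  by rewrite big_nil -(rmorph1 polyC) cevalC scale1r; exists 1; rewrite mulr1.
rewrite big_cons cevalM; apply: op_invertibleM; last first.
  by apply: IH => y yrs; apply: rsT; rewrite in_cons yrs orbT.
rewrite cevalD cevalX -polyCN cevalC scaleNr.
by apply: rsT; rewrite mem_head.
Qed.

(** The other half: [X - t] divides [p - p(t)], and polynomials in [T] commute. *)
Lemma spectrum_horner p T (t : R) : spectrum T t%:C ->
  spectrum (op_horner p T) (p.[t])%:C.
Proof.
move=> Tt inv; apply: Tt.
have /factor_theorem[q qE] : root (p - (p.[t])%:P) t by rewrite rootE !hornerE subrr.
have {}inv : op_invertible (op_horner (p - (p.[t])%:P) T).
  by rewrite op_hornerD -polyCN op_hornerC /op_scalar rmorphN scaleNr.
rewrite qE mulrC op_hornerM in inv.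
have -> : T - (t%:C *: (1 : bop H)) = op_horner ('X - t%:P) T.
  by rewrite op_hornerD op_hornerX -polyCN op_hornerC /op_scalar rmorphN scaleNr.
apply: op_invertible_comm inv.
by rewrite -!op_hornerM mulrC.
Qed.

(** The least spectral value of [p(T)] bounds its numerical range from below,
    and by the spectral mapping it is [p(t)] for some [t] in the spectrum of [T]. *)
Lemma op_horner_ge0 p T (x0 : H) : x0 != 0 -> selfadjoint T ->
  (forall t, spectrum T t%:C -> 0 <= p.[t]) -> op_ge0 (op_horner p T).
Proof.
move=> x00 sT p0; have sp := selfadjoint_horner p sT; apply/(op_ge0P sp) => x.
have [b Tb _] := inf_spectrum x00 sT.
have [a Sa aP] := inf_spectrum x00 sp.
apply: le_trans (aP x); apply: mulr_ge0; last exact: sqr_ge0.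
have [z Tz] : exists2 z, spectrum T z & root (map_poly (real_complex R) (p - a%:P)) z.
  apply: spectrum_root_of_ceval Tb _; rewrite -op_hornerE op_hornerD -polyCN op_hornerC.
  by rewrite /op_scalar rmorphN scaleNr.
rewrite rootE (spec_real sT Tz) horner_map !hornerE /=.
rewrite -(rmorph0 (real_complex R)) (inj_eq (@complexI R)) subr_eq0 => /eqP <-.
by apply: p0; rewrite -(spec_real sT Tz).
Qed.

(** Apply positivity to [c ^ 2 - p ^ 2]; the operator [p(T)] is self-adjoint, so
    [rdot (p(T) ^ 2 x) x] is the square of [nrm (p(T) x)]. *)
Lemma bounded_by_horner p T (x0 : H) c : x0 != 0 -> selfadjoint T -> 0 <= c ->
  (forall t, spectrum T t%:C -> `|p.[t]| <= c) -> bounded_by (op_horner p T) c.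
Proof.
move=> x00 sT c0 pc x; have sp := selfadjoint_horner p sT.
have : op_ge0 (op_horner ((c ^+ 2)%:P - p * p) T).
  apply: op_horner_ge0 x00 sT _ => t Tt; rewrite !hornerE subr_ge0 -expr2.
  by rewrite -[leLHS]real_normK ?num_real// ler_pXn2r ?nnegrE// pc.
have s2 := selfadjoint_horner ((c ^+ 2)%:P - p * p) sT.
move/(op_ge0P s2)/(_ x); rewrite op_hornerD op_hornerC -mulN1r -polyC1 -polyCN.
rewrite mul_polyC op_hornerZ op_hornerM !opE rmorphN1 scaleN1r.
rewrite rdotBl rdotZl (sa_rdot _ _ sp) !rdotxx subr_ge0 -exprMn => h.
by rewrite -(@ler_pXn2r _ 2) ?nnegrE ?nrm_ge0 ?mulr_ge0 ?nrm_ge0.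
Qed.

(** One polynomial for each precision replaces the converging sequence, and the
    closure properties of the calculus become estimates with a single [e]. *)
Lemma is_cfcP (f : R -> R) T S : is_cfc f T S <-> forall e, 0 < e -> exists p,
  (forall t, spectrum T t%:C -> `|p.[t] - f t| <= e) /\ bounded_by (S - op_horner p T) e.
Proof.
split=> [[p [pf pS]] e e0|h].
  have : \forall n \near \oo, forall t, spectrum T t%:C -> `|(p n).[t] - f t| <= e.
    have : nbhs (f : {uniform` [set t : R | spectrum T t%:C] -> R})
        [set h | forall t, spectrum T t%:C -> `|h t - f t| <= e].
      apply/uniform_nbhs; exists [set xy | ball xy.1 e xy.2]; split.
        exact: (entourage_ball _ (PosNum e0)).
      move=> h hP t /hP; rewrite /= /ball /= distrC; exact: ltW.
    by move/pf.
  have : \forall n \near \oo, opnorm (S - op_horner (p n) T) <= e.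
    have /cvgrPdist_le/(_ e e0) := pS; apply: filterS => n.
    by rewrite sub0r normrN => /ler_normlW.
  move=> A B; have [n [An Bn]] := filter_ex (filterI A B).
  by exists (p n); split=> //; apply: bounded_by_le An (bounded_by_opnorm _).
have inv0 n : 0 < (n.+1%:R^-1 : R) by rewrite invr_gt0 ltr0n.
have /choice[p pP] := fun n => h _ (inv0 n).
have small e : 0 < e -> \forall n \near \oo, (n.+1%:R^-1 : R) < e.
  by move=> e0; exact: (near_infty_natSinv_lt (PosNum e0)).
exists p; split.
  move=> W /uniform_nbhs[E []]; rewrite -entourage_ballE => -[e /= e0 eE] EW.
  have := small e e0; apply: filterS => n ne; apply: EW => t Tt; apply: eE.
  by rewrite /= /ball /= distrC; apply: le_lt_trans ne; apply: (pP n).1.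
apply/cvgrPdist_le => e e0; have := small e e0; apply: filterS => n ne.
rewrite sub0r normrN ger0_norm ?opnorm_ge0// (le_trans _ (ltW ne))//.
by apply: opnorm_le; [exact: ltW|exact: (pP n).2].
Qed.

End PolynomialCalculus.

(** * Weierstrass approximation *)

Section Weierstrass.
Variable R : realType.
Implicit Types (f g : R -> R) (a b e x : R).

(** The Bernstein polynomial of order [n]: at [x] in [[0, 1]] it is the
    expectation of [h] at the number of successes in [n] trials of probability
    [x], here computed by conditioning on the first trial. This recursion avoids
    binomial coefficients. *)
Fixpoint bern (n : nat) (h : nat -> R) : {poly R} :=
  if n is n'.+1 then 'X * bern n' (fun k => h k.+1) + (1%:P - 'X) * bern n' h
  else (h 0%N)%:P.

(** The mean [n x] and the variance [n x (1 - x)] of the binomial law, in the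
    form that is stable under the recursion. *)
Lemma bern_moment n a b c x :
  (bern n (fun k => a + b * k%:R + c * k%:R ^+ 2)).[x] =
  a + b * (n%:R * x) + c * (n%:R * x * (1 - x) + (n%:R * x) ^+ 2).
Proof.
elim: n a b c => [|n IH] a b c /=; first by rewrite hornerC mulr0n; ring.
have -> : (fun k => a + b * k.+1%:R + c * k.+1%:R ^+ 2) =
  (fun k => (a + b + c) + (b + 2 * c) * k%:R + c * k%:R ^+ 2) :> (nat -> R).
  by apply/funext => k; rewrite -(natr1 k); ring.
by rewrite !(hornerD, hornerN, hornerM, hornerX, hornerC) !IH -(natr1 n); ring.
Qed.

Lemma bern_le n (h1 h2 : nat -> R) x : 0 <= x <= 1 ->
  (forall k, (k <= n)%N -> h1 k <= h2 k) -> (bern n h1).[x] <= (bern n h2).[x].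
Proof.
move=> /andP[x0 x1]; elim: n h1 h2 => [|n IH] h1 h2 h12 /=.
  by rewrite !hornerE h12.
rewrite !(hornerD, hornerN, hornerM, hornerX, hornerC) lerD// ler_wpM2l ?subr_ge0//;
  apply: IH => k kn; apply: h12 => //.
exact: leqW.
Qed.

(** A quadratic modulus of continuity matches the second moment: the expectation
    of the quadratic term is [C] times the variance of the frequency of successes,
    and thus at most [C / n.+1]. *)
Lemma bernstein_approx g C e n x : 0 <= C -> 0 <= x <= 1 -> 
  (forall s t, 0 <= s <= 1 -> 0 <= t <= 1 -> `|g s - g t| <= e + C * (s - t) ^+ 2) ->
  `|(bern n.+1 (fun k => g (k%:R / n.+1%:R))).[x] - g x| <= e + C / n.+1%:R.
Proof.
move=> C0 x01 gC; set N : R := n.+1%:R; have N0 : 0 < N by rewrite ltr0n.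
have hk k : (k <= n.+1)%N -> `|g (k%:R / N) - g x| <= e + C * (k%:R / N - x) ^+ 2.
  move=> kn; apply: gC => //; rewrite divr_ge0// ?ler0n ?(ltW N0)//=.
  by rewrite ler_pdivrMr// mul1r ler_nat.
have sq d (k : nat) : g x + d * (e + C * x ^+ 2) + d * (- 2 * C * x / N) * k%:R +
    d * (C / N ^+ 2) * k%:R ^+ 2 = g x + d * (e + C * (k%:R / N - x) ^+ 2).
  by field; rewrite gt_eqF.
have val d : g x + d * (e + C * x ^+ 2) + d * (- 2 * C * x / N) * (N * x) +
    d * (C / N ^+ 2) * (N * x * (1 - x) + (N * x) ^+ 2) = g x + d * (e + C * (x * (1 - x)) / N).
  by field; rewrite gt_eqF.
have le1 : C * (x * (1 - x)) / N <= C / N.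
  by rewrite ler_wpM2r ?invr_ge0 ?(ltW N0)// ler_piMr//; case/andP: x01 => *; nra.
rewrite ler_norml; apply/andP; split.
  have : (bern n.+1 (fun k => g x + -1 * (e + C * x ^+ 2) + -1 * (- 2 * C * x / N) * k%:R
      + -1 * (C / N ^+ 2) * k%:R ^+ 2)).[x] <= (bern n.+1 (fun k => g (k%:R / N))).[x].
    by apply: bern_le => // k /hk; rewrite sq ler_norml; set E := e + _ => /andP[]; lra.
  rewrite bern_moment val; move: le1; set u := C * _ / N; set w := C / N.
  by set q := horner _ _; lra.
have : (bern n.+1 (fun k => g (k%:R / N))).[x] <=
    (bern n.+1 (fun k => g x + 1 * (e + C * x ^+ 2) + 1 * (- 2 * C * x / N) * k%:R
      + 1 * (C / N ^+ 2) * k%:R ^+ 2)).[x].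
  apply: bern_le => // k /hk; rewrite sq ler_norml; set E := e + _ => /andP[]; lra.
rewrite bern_moment val; move: le1; set u := C * _ / N; set w := C / N.
by set q := horner _ _; lra.
Qed.

Lemma within_continuousP (A : set R) f x e : {within A, continuous f} -> A x -> 0 < e ->
  exists2 d, 0 < d & forall t, A t -> `|x - t| < d -> `|f x - f t| <= e.
Proof.
move=> fc Ax e0.
have /cvgrPdist_le/(_ e e0) : f @ within A (nbhs x) --> f x.
  by rewrite (nbhs_subspace_in Ax); exact: fc.
move=> /nbhs_ballP[d d0 dP].
by exists d => // t At xt; apply: (dP t).
Qed.

(** Heine-Cantor for a compact set of real numbers. *)
Lemma uniform_modulus (A : set R) f e : compact A -> {within A, continuous f} -> 0 < e ->
  exists2 d, 0 < d & forall s t, A s -> A t -> `|s - t| < d -> `|f s - f t| <= e.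
Proof.
move=> /compact_near_coveringP cov fc e0.
have [|d /= d0 dP] := cov _ (0^'+ : set_system R)
  (fun d s => A s -> forall t, A t -> `|s - t| < d -> `|f s - f t| <= e) _.
  move=> x Ax.
  have [d d0 dP] := within_continuousP fc Ax (divr_gt0 e0 (ltr0Sn R 1)).
  exists (ball x (d / 2), [set r | r < d / 2]).
    split; first by apply: nbhsx_ballx; rewrite divr_gt0.
    by apply: nbhs_right_lt; rewrite divr_gt0.
  move=> [s r] [/= xs rd] As t At st.
  have fs : `|f x - f s| <= e / 2 by apply: dP => //; move: xs; rewrite /ball /=; lra.
  have ft : `|f x - f t| <= e / 2.
    apply: dP => //; move: xs; rewrite /ball /= => xs.
    have -> : x - t = (x - s) + (s - t) by ring.
    rewrite (le_lt_trans (ler_normD _ _))//; lra.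
  have -> : f s - f t = (f x - f t) - (f x - f s) by ring.
  rewrite (le_trans (ler_normB _ _))//; lra.
exists (d / 2); first by rewrite divr_gt0.
move=> s t As At st; apply: (dP (d / 2)) => //=.
  by rewrite /ball /= sub0r normrN gtr0_norm ?divr_gt0//; lra.
by rewrite divr_gt0.
Qed.

(** Nearby points are handled by uniform continuity. For points at distance at
    least [d], a large [C] makes [C * d ^+ 2] exceed twice the bound of [f]. *)
Lemma quadratic_modulus (A : set R) f e : compact A -> {within A, continuous f} -> 0 < e ->
  exists2 C, 0 <= C & forall s t, A s -> A t -> `|f s - f t| <= e + C * (s - t) ^+ 2.
Proof.
move=> cA fc e0; have [d d0 dP] := uniform_modulus cA fc e0.
have [B BP] : exists B, forall s, A s -> `|f s| <= B.
  have /compact_bounded[B [_ /(_ (B + 1))]] := continuous_compact fc cA.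
  by rewrite ltrDl ltr01 => /(_ isT) BP; exists (B + 1) => s As; apply: BP; exists s.
have B0 : 0 <= 2 * `|B| by rewrite mulr_ge0.
have C0 : 0 <= 2 * `|B| / d ^+ 2 by apply: divr_ge0 => //; exact: sqr_ge0.
exists (2 * `|B| / d ^+ 2) => // s t As At.
have p0 : 0 <= 2 * `|B| / d ^+ 2 * (s - t) ^+ 2 by apply: mulr_ge0 => //; exact: sqr_ge0.
have [st|st] := ltP `|s - t| d; first by rewrite (le_trans (dP s t As At st))// lerDl.
rewrite (le_trans (ler_normB _ _))//.
have := BP s As; have := BP t At; have := ler_norm B.
suff : 2 * `|B| <= 2 * `|B| / d ^+ 2 * (s - t) ^+ 2 by lra.
rewrite mulrAC ler_pdivlMr ?exprn_gt0// ler_wpM2l//.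
by rewrite -[leRHS]real_normK ?num_real// ler_pXn2r ?nnegrE ?(ltW d0).
Qed.

Lemma weierstrass f a b e : {within `[a, b], continuous f} -> 0 < e ->
  exists p : {poly R}, forall t, a <= t <= b -> `|p.[t] - f t| <= e.
Proof.
move=> fc e0; have e20 : 0 < e / 2 by rewrite divr_gt0.
have [C C0 CP] := quadratic_modulus (@segment_compact _ a b) fc e20.
have [ab|ba] := ltP a b; last first.
  exists (f a)%:P => t /andP[at_ tb].
  have -> : t = a by apply/eqP; rewrite eq_le at_ andbT (le_trans tb ba).
  by rewrite hornerC subrr normr0 ltW.
pose l := b - a; have l0 : 0 < l by rewrite subr_gt0.
pose g u := f (a + l * u).
have gC u v : 0 <= u <= 1 -> 0 <= v <= 1 -> `|g u - g v| <= e / 2 + C * l ^+ 2 * (u - v) ^+ 2.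
  move=> u01 v01; apply: le_trans (CP _ _ _ _) _.
  - by rewrite /= in_itv /=; move: l0 u01; rewrite /l => ? /andP[? ?]; apply/andP; split; nra.
  - by rewrite /= in_itv /=; move: l0 v01; rewrite /l => ? /andP[? ?]; apply/andP; split; nra.
  by rewrite le_eqVlt; apply/orP; left; apply/eqP; ring.
have D0 : 0 <= C * l ^+ 2 by rewrite mulr_ge0 ?sqr_ge0.
pose n := Num.bound ((e / 2)^-1 * (C * l ^+ 2)).
exists (bern n.+1 (fun k => g (k%:R / n.+1%:R)) \Po (l^-1 *: ('X - a%:P))) => t /andP[at_ tb].
rewrite horner_comp hornerZ hornerXsubC; set u := l^-1 * (t - a).
have -> : f t = g u by rewrite /g /u mulrA divff ?gt_eqF// mul1r addrC subrK.
have u01 : 0 <= u <= 1.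
  rewrite /u mulrC ler_pdivrMr// mul1r lerD2r tb andbT.
  by rewrite divr_ge0 ?subr_ge0// ltW.
apply: le_trans (bernstein_approx n D0 u01 gC) _.
rewrite {2}(splitr e) lerD2l ler_pdivrMr ?ltr0n// -ler_pdivrMl//.
rewrite (le_trans (ltW (archi_boundP _))) ?ler_nat//.
by rewrite mulr_ge0 ?invr_ge0// ltW.
Qed.
End Weierstrass.

(** * Order and existence in the functional calculus *)

Section FunctionalCalculus.
Variables (R : realType) (H : hilbertType R).
Implicit Types (x y : H) (S T U : bop H) (a b c e : R) (p q : {poly R}) (f g : R -> R).

Lemma is_cfc_horner p T : is_cfc (fun t => p.[t]) T (op_horner p T).
Proof.
apply/is_cfcP => e e0; exists p; split=> [t _|x]; first by rewrite subrr normr0 ltW.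
by rewrite subrr op0 nrm0 mulr_ge0 ?nrm_ge0 ?ltW.
Qed.

Lemma is_cfcD f g T S U : is_cfc f T S -> is_cfc g T U ->
  is_cfc (fun t => f t + g t) T (S + U).
Proof.
move=> /is_cfcP fS /is_cfcP gU; apply/is_cfcP => e e0.
have e20 : 0 < e / 2 by rewrite divr_gt0.
have [p [pf pS]] := fS _ e20; have [q [qg qU]] := gU _ e20.
exists (p + q); split=> [t Tt|].
  rewrite hornerD opprD addrACA [leRHS]splitr (le_trans (ler_normD _ _))// lerD//.
    exact: pf.
  exact: qg.
by rewrite op_hornerD opprD addrACA [X in bounded_by _ X]splitr; apply: bounded_byD.
Qed.

Lemma is_cfcZ a f T S : is_cfc f T S -> is_cfc (fun t => a * f t) T (a%:C *: S).
Proof.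
move=> /is_cfcP fS; apply/is_cfcP => e e0.
have d0 : 0 < `|a| + 1 by rewrite ltr_wpDl.
have ed0 : 0 < e / (`|a| + 1) by rewrite divr_gt0.
have ae : `|a| * (e / (`|a| + 1)) <= e.
  by rewrite mulrCA ler_piMr ?(ltW e0)// ler_pdivrMr// mul1r lerDl.
have [p [pf pS]] := fS _ ed0; exists (a *: p); split=> [t Tt|].
  rewrite hornerZ -mulrBr normrM (le_trans _ ae)// ler_wpM2l//; exact: pf.
by rewrite op_hornerZ -scalerBr; apply: bounded_by_le ae _; apply: bounded_byZ.
Qed.

Lemma is_cfcN f T S : is_cfc f T S -> is_cfc (fun t => - f t) T (- S).
Proof.
move=> /(is_cfcZ (-1)); rewrite rmorphN1 scaleN1r.
by congr is_cfc; apply/funext => t; rewrite mulN1r.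
Qed.

(** Composition with a polynomial, through the inclusion of [q(spectrum T)] in
    the spectrum of [q(T)]. *)
Lemma is_cfc_comp f q T S : is_cfc f (op_horner q T) S -> is_cfc (fun t => f q.[t]) T S.
Proof.
move=> /is_cfcP fS; apply/is_cfcP => e e0; have [p [pf pS]] := fS e e0.
exists (p \Po q); split=> [t Tt|]; last by rewrite op_horner_comp.
by rewrite horner_comp; apply: pf; apply: spectrum_horner.
Qed.

Lemma le0_of_small_multiples a c : 0 <= c -> (forall e, 0 < e -> a <= e * c) -> a <= 0.
Proof.
move=> c0 h; apply/ler_addgt0Pr => e e0; rewrite add0r.
have d0 : 0 < c + 1 by rewrite ltr_wpDl.
apply: le_trans (h _ (divr_gt0 e0 d0)) _.
by rewrite mulrAC ler_pdivrMr// ler_wpM2l ?(ltW e0)// lerDl.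
Qed.

(** If [p] approximates [f] within [e] on the spectrum, then [p + e] is
    nonnegative there and [S] is within [2 e] of the nonnegative operator
    [(p + e)(T)]. The proof also obtains that [hdot (S x) x] is real, which is
    part of [op_ge0]. *)
Lemma is_cfc_ge0 f T S (x0 : H) : x0 != 0 -> selfadjoint T -> is_cfc f T S ->
  (forall t, spectrum T t%:C -> 0 <= f t) -> op_ge0 S.
Proof.
move=> x00 sT /is_cfcP fS f0 x; rewrite lecE /=.
have n0 := nrm_ge0 x; have nn : 0 <= nrm x ^+ 2 by exact: sqr_ge0.
have key e : 0 < e -> `|complex.Im (hdot (S x) x)| <= e * nrm x ^+ 2 /\
    - rdot (S x) x <= e * (2 * nrm x ^+ 2).
  move=> e0; have [p [pf pS]] := fS e e0.
  have sp := selfadjoint_horner p sT.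
  have h1 : nrm ((S - op_horner p T) x) * nrm x <= e * nrm x ^+ 2.
    by rewrite expr2 mulrA ler_wpM2r.
  split.
    have -> : complex.Im (hdot (S x) x) = complex.Im (hdot ((S - op_horner p T) x) x).
      by rewrite !opE linearBl /= raddfB /= (sa_Im _ sp) subr0.
    by rewrite Im_hdot (le_trans (rdot_norm_le _ _))// nrmNiZ.
  have : op_ge0 (op_horner (p + e%:P) T).
    apply: op_horner_ge0 x00 sT _ => t Tt; rewrite hornerD hornerC.
    by have := pf t Tt; have := f0 t Tt; rewrite ler_norml => ? /andP[? ?]; lra.
  have spe := selfadjoint_horner (p + e%:P) sT.
  move=> /(op_ge0P spe)/(_ x); rewrite op_hornerD op_hornerC !opE rdotDl rdotZl rdotxx.
  have := rdot_norm_le ((S - op_horner p T) x) x; rewrite ler_norml !opE rdotBl.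
  by rewrite !opE in h1; move=> /andP[? ?]; lra.
apply/andP; split.
  rewrite -normr_le0; apply: (le0_of_small_multiples nn) => e /key[] //.
rewrite -oppr_le0; apply: (@le0_of_small_multiples _ (2 * nrm x ^+ 2)); first by rewrite mulr_ge0.
by move=> e /key[].
Qed.

(** Weierstrass polynomials are uniformly Cauchy on the spectrum, so by
    [bounded_by_horner] their values at [T] form a Cauchy sequence of operators. *)
Lemma is_cfc_exists f T a b (x0 : H) : x0 != 0 -> selfadjoint T ->
  {within `[a, b], continuous f} -> (forall t, spectrum T t%:C -> a <= t <= b) ->
  exists S, is_cfc f T S.
Proof.
move=> x00 sT fc ab.
have inv0 n : 0 < (n.+1%:R^-1 : R) by rewrite invr_gt0 ltr0n.
have small e : 0 < e -> exists N, forall n, (N <= n)%N -> (n.+1%:R^-1 : R) <= e.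
  move=> e0; have [N _ NP] := near_infty_natSinv_lt (PosNum e0).
  by exists N => n Nn; apply/ltW/NP.
have /choice[p pP] := fun n => weierstrass fc (inv0 n).
have [S SP] : exists S, forall e, 0 < e -> exists N, forall n, (N <= n)%N ->
    bounded_by (op_horner (p n) T - S) e.
  apply: bop_complete => e e0.
  have [N NP] := small _ (divr_gt0 e0 (ltr0Sn R 1)); exists N => n k Nn Nk.
  have -> : op_horner (p n) T - op_horner (p k) T = op_horner (p n - p k) T.
    by rewrite -(scaleN1r (p k)) op_hornerD op_hornerZ rmorphN1 scaleN1r.
  apply: (bounded_by_horner x00 sT (ltW e0)) => t Tt; rewrite hornerD hornerN.
  have -> : (p n).[t] - (p k).[t] = ((p n).[t] - f t) - ((p k).[t] - f t) by ring.
  rewrite (le_trans (ler_normB _ _))// [leRHS]splitr lerD//.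
    by apply: le_trans (NP n Nn); apply/pP/ab.
  by apply: le_trans (NP k Nk); apply/pP/ab.
exists S; apply/is_cfcP => e e0.
have [N1 P1] := SP e e0; have [N2 P2] := small e e0.
exists (p (maxn N1 N2)); split=> [t Tt|].
  by apply: le_trans (P2 _ (leq_maxr N1 N2)); apply/pP/ab.
by rewrite -opprB; apply/bounded_byN/P1/leq_maxl.
Qed.

Lemma is_cfc_cfc f T S : is_cfc f T S -> is_cfc f T (cfc f T).
Proof. exact: xgetI. Qed.

Lemma op_le_scalarP T b : T <=op op_scalar b -> forall x, rdot (T x) x <= b * nrm x ^+ 2.
Proof.
move=> le x; have : 0 <= rdot ((op_scalar b - T) x) x by have := le x; rewrite lecE => /andP[].
by rewrite !opE rdotBl rdotZl rdotxx subr_ge0.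
Qed.

Lemma op_ge_scalarP T a : op_scalar a <=op T -> forall x, a * nrm x ^+ 2 <= rdot (T x) x.
Proof.
move=> le x; have : 0 <= rdot ((T - op_scalar a) x) x by have := le x; rewrite lecE => /andP[].
by rewrite !opE rdotBl rdotZl rdotxx subr_ge0.
Qed.

Lemma sup_spectrum T (x0 : H) : x0 != 0 -> selfadjoint T ->
  exists2 b, spectrum T b%:C & forall x, rdot (T x) x <= b * nrm x ^+ 2.
Proof.
move=> x00 sT; have [a Ta aP] := inf_spectrum x00 (selfadjointN sT).
exists (- a) => [inv|x]; last by have := aP x; rewrite opE rdotNl mulNr lerNr.
have N10 : (-1 : R[i]) != 0 by rewrite oppr_eq0 oner_eq0.
apply: Ta; have := op_invertibleZ N10 inv.
by rewrite scaleN1r opprB rmorphN scaleNr addrC.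
Qed.

(** Both ends of the numerical range are spectral values, so they lie in [J], and
    so does the segment between them, on which [f] is continuous. *)
Lemma cfc_spec f (J : set R) T (x0 : H) : x0 != 0 -> is_interval J ->
  {within J, continuous f} -> selfadjoint_in J T -> is_cfc f T (cfc f T).
Proof.
move=> x00 Ji fc [sT TJ].
have [a Ta aP] := inf_spectrum x00 sT; have [b Tb bP] := sup_spectrum x00 sT.
have Ja : J a by have [t Jt /complexI <-] := TJ _ Ta.
have Jb : J b by have [t Jt /complexI <-] := TJ _ Tb.
have [S fS] : exists S, is_cfc f T S.
  apply: (@is_cfc_exists f T a b x0) => //.
    apply: continuous_subspaceW fc => t /=; rewrite in_itv /=; exact: Ji.
  by move=> t Tt; rewrite (spec_ge aP Tt) (spec_le bP Tt).
exact: is_cfc_cfc fS.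
Qed.

End FunctionalCalculus.

(** * Chords of convex functions; positive averages *)

Section ScalarInequalities.
Variables (R : realType) (J : set R) (f : R -> R).
Hypothesis convf : convex_function (J : set R^o) f.
Implicit Types x y z t m M : R.

(** Convexity without a division, with degenerate segments allowed. *)
Lemma three_chord x y z : J x -> J z -> x <= y <= z ->
  (z - x) * f y <= (z - y) * f x + (y - x) * f z.
Proof.
move=> Jx Jz /andP[xy yz]; have [zx|xz] := leP z x.
  have -> : y = x by apply/eqP; rewrite eq_le xy (le_trans yz).
  have -> : z = x by apply/eqP; rewrite eq_le zx (le_trans xy).
  by rewrite !subrr !mul0r addr0.
have d0 : 0 < z - x by rewrite subr_gt0.
have s0 : 0 <= (z - y) / (z - x) by rewrite divr_ge0 ?subr_ge0// ltW.
have s1 : (z - y) / (z - x) <= 1 by rewrite ler_pdivrMr// mul1r lerB.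
have : f ((z - y) / (z - x) * x + (1 - (z - y) / (z - x)) * z) <=
    (z - y) / (z - x) * f x + (1 - (z - y) / (z - x)) * f z.
  exact: (convf (Itv01 s0 s1) (mem_set Jx) (mem_set Jz)).
have -> : (z - y) / (z - x) * x + (1 - (z - y) / (z - x)) * z = y.
  by field; rewrite gt_eqF.
rewrite -(ler_pM2l d0) => /le_trans; apply.
by rewrite le_eqVlt; apply/orP; left; apply/eqP; field; rewrite gt_eqF.
Qed.

Variables m M : R.
Hypotheses (Ji : is_interval J) (Jm : J m) (JM : J M) (mM : m < M).

Lemma delta_f_ge0 : 0 <= delta_f f m M.
Proof.
have := @three_chord m ((m + M) / 2) M Jm JM.
have -> : M - (m + M) / 2 = (M - m) / 2 by field.
have -> : (m + M) / 2 - m = (M - m) / 2 by field.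
rewrite /delta_f => h.
have {}h : (M - m) * f ((m + M) / 2) <= (M - m) / 2 * f m + (M - m) / 2 * f M.
  by apply: h; apply/andP; split; move: mM; lra.
have d0 : 0 < M - m by rewrite subr_gt0.
rewrite -(pmulr_rge0 _ d0); lra.
Qed.

(** [chord_slope * t + chord_const] is the chord of [f] over [[m, M]]. *)
Definition chord_slope := (f M - f m) / (M - m).
Definition chord_const := f m - chord_slope * m.

Lemma chord_mul t : (M - m) * (chord_slope * t + chord_const) = (M - t) * f m + (t - m) * f M.
Proof. by rewrite /chord_const /chord_slope; field; rewrite subr_eq0 gt_eqF. Qed.

(** Extended beyond [[m, M]], the chord lies below a convex function. *)
Lemma chord_le_outside t : J t -> t <= m \/ M <= t -> chord_slope * t + chord_const <= f t.
Proof.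
move=> Jt; have d0 : 0 < M - m by rewrite subr_gt0.
move=> tmM; rewrite -(ler_pM2l d0) chord_mul; case: tmM => [tm|Mt].
  by have := @three_chord t m M Jt JM; rewrite tm (ltW mM) => /(_ isT); lra.
by have := @three_chord m M t Jm Jt; rewrite Mt (ltW mM) => /(_ isT); lra.
Qed.

(** On each half of [[m, M]] the right-hand side is the chord of [f] over that
    half: the correction vanishes at the ends and equals [delta_f / 2] at the
    midpoint, where the bound is [f] of the midpoint. *)
Lemma refined_chord t : m <= t <= M ->
  f t <= chord_slope * t + chord_const -
    delta_f f m M * (1 / 2 - (M - m)^-1 * `|t - (m + M) / 2|).
Proof.
move=> /andP[mt tM]; have d0 : 0 < M - m by rewrite subr_gt0.
rewrite -(ler_pM2l d0) mulrBr chord_mul.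
have -> : (M - m) * (delta_f f m M * (1 / 2 - (M - m)^-1 * `|t - (m + M) / 2|)) =
    delta_f f m M * ((M - m) / 2 - `|t - (m + M) / 2|).
  by field; rewrite gt_eqF.
set h := (m + M) / 2.
have hm : h - m = (M - m) / 2 by rewrite /h; field.
have Mh : M - h = (M - m) / 2 by rewrite /h; field.
have Jh : J h by apply: (Ji Jm JM); apply/andP; split; lra.
rewrite /delta_f -/h.
have [th|ht] := leP t h.
  rewrite ler0_norm ?subr_le0//.
  have := @three_chord m t h Jm Jh; rewrite mt th => /(_ isT); rewrite hm.
  move: (f h) => fh le; rewrite -subr_ge0 in le.
  rewrite -subr_ge0; apply: le_trans (mulr_ge0 (ler0n _ 2) le) _.
  by rewrite le_eqVlt; apply/orP; left; apply/eqP; rewrite /h; field.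
rewrite ger0_norm ?subr_ge0 ?(ltW ht)//.
have := @three_chord h t M Jh JM; rewrite tM (ltW ht) => /(_ isT); rewrite Mh.
move: (f h) => fh le; rewrite -subr_ge0 in le.
rewrite -subr_ge0; apply: le_trans (mulr_ge0 (ler0n _ 2) le) _.
by rewrite le_eqVlt; apply/orP; left; apply/eqP; rewrite /h; field.
Qed.
End ScalarInequalities.

Section Averages.
Variables (R : realType) (H : hilbertType R) (n : nat).
Variables (Phi : 'I_n -> {linear bop H -> bop H}) (alpha : R).
Hypotheses (Phi_pos : forall i, positive_map (Phi i)) (alpha_gt0 : 0 < alpha)
  (sum_Phi : \sum_i Phi i 1 = op_scalar alpha).
Implicit Types X Y : 'I_n -> bop H.

Lemma op_ge0D (S T : bop H) : op_ge0 S -> op_ge0 T -> op_ge0 (S + T).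
Proof. by move=> S0 T0 x; rewrite opE linearDl; exact: addr_ge0 (S0 x) (T0 x). Qed.

Lemma op_ge0Z a (T : bop H) : 0 <= a -> op_ge0 T -> op_ge0 (a%:C *: T).
Proof. by move=> a0 T0 x; rewrite opE linearZl_LR; apply: mulr_ge0 (T0 x); rewrite ler0c. Qed.

Definition avg X : bop H := alpha^-1 *op (\sum_i Phi i (X i)).

Lemma avg_ge0 X : (forall i, op_ge0 (X i)) -> op_ge0 (avg X).
Proof.
move=> X0; apply: op_ge0Z; first by rewrite invr_ge0 ltW.
apply: (big_ind (fun S => op_ge0 S)) => [x||i _]; first by rewrite opE linear0l.
  exact: op_ge0D.
exact/Phi_pos/X0.
Qed.

Lemma avgB X Y : avg (fun i => X i - Y i) = avg X - avg Y.
Proof.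
rewrite /avg /op_rscale -scalerBr -sumrB; congr (_ *: _).
by apply: eq_bigr => i _; rewrite linearB.
Qed.

Lemma avgZ a X : avg (fun i => a%:C *: X i) = a%:C *: avg X.
Proof.
rewrite /avg /op_rscale.
have -> : \sum_i Phi i (a%:C *: X i) = a%:C *: \sum_i Phi i (X i).
  by rewrite scaler_sumr; apply: eq_bigr => i _; rewrite linearZ.
by rewrite !scalerA mulrC.
Qed.

Lemma avgN X : avg (fun i => - X i) = - avg X.
Proof.
rewrite /avg /op_rscale -scalerN -sumrN; congr (_ *: _).
by apply: eq_bigr => i _; rewrite linearN.
Qed.

Lemma avg_scalar a : avg (fun=> op_scalar a) = op_scalar a.
Proof.
rewrite avgZ /avg sum_Phi /op_rscale /op_scalar !scalerA -!rmorphM /=.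
by rewrite mulVf ?mulr1// gt_eqF.
Qed.

Lemma avg_le a X : (forall i, X i <=op op_scalar a) -> avg X <=op op_scalar a.
Proof. by move=> Xa; rewrite /op_le -(avg_scalar a) -avgB; apply: avg_ge0. Qed.

Lemma avg_ge a X : (forall i, op_scalar a <=op X i) -> op_scalar a <=op avg X.
Proof. by move=> Xa; rewrite /op_le -(avg_scalar a) -avgB; apply: avg_ge0. Qed.

End Averages.

(** * Operator inequalities for convex functions *)

Lemma sum_four_cancel (V : zmodType) (a b p q r s c u v y z : V) : p + q = r + s ->
  (a - p - c) + (b - q - c) + ((r + c - u - y) + (s + c - v - z)) =
  a + b - (u + v) - (y + z).
Proof.
move=> pqrs; rewrite [a - p - c + _]addrACA [a - p + _]addrACA -!opprD pqrs.
rewrite [r + c - u - y + _]addrACA [r + c - u + _]addrACA [r + c + _]addrACA -!opprD.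
rewrite -(addrA _ (- (r + s))) -opprD.
move: (r + s + (c + c)) (a + b) (u + v) (y + z) => X P W Z.
by rewrite !addrA subrK.
Qed.

Section OperatorInequalities.
Variables (R : realType) (H : hilbertType R) (x0 : H).
Hypothesis x00 : x0 != 0.
Implicit Types (S T U : bop H).

(** An empty family would give [op_scalar alpha = 0]. *)
Lemma avg_inhabited n (Phi : 'I_n -> {linear bop H -> bop H}) (alpha : R) :
  0 < alpha -> \sum_i Phi i 1 = op_scalar alpha -> exists i : 'I_n, True.
Proof.
case: n Phi => [|n] Phi a0; last by exists ord0.
rewrite big_ord0 => /(congr1 (fun T : bop H => T x0)) /eqP.
rewrite eq_sym /= scaler_eq0 (negbTE x00) orbF -(rmorph0 (real_complex R)).
by rewrite (inj_eq (@complexI R)) gt_eqF.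
Qed.

(** [op_abs] is defined through the square of [T - h]; as that square is a
    polynomial in [T], the absolute value is itself a function of [T] and can be
    compared with other functions of [T]. *)
Lemma op_abs_cfc T h : selfadjoint T ->
  is_cfc (fun t => `|t - h|) T (op_abs (T - op_scalar h)).
Proof.
move=> sT; set q : {poly R} := ('X - h%:P) ^+ 2.
have qE : (T - op_scalar h) ^+ 2 = op_horner q T.
  rewrite /q !expr2 op_hornerM op_hornerD op_hornerX -polyCN op_hornerC.
  by rewrite /op_scalar rmorphN scaleNr.
have -> : (fun t => `|t - h|) = (fun t => Num.sqrt q.[t]).
  by apply/funext => t; rewrite /q horner_exp hornerXsubC sqrtr_sqr.
apply: is_cfc_comp; rewrite /op_abs qE.
have sq := selfadjoint_horner q sT; have [K K0 KP] := bop_bounded (op_horner q T).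
have bnd x : `|rdot (op_horner q T x) x| <= K * nrm x ^+ 2.
  by rewrite (le_trans (rdot_norm_le _ _))// expr2 mulrA ler_wpM2r ?nrm_ge0.
have [|t Tt|S] := @is_cfc_exists R H Num.sqrt (op_horner q T) (- K) K x0 x00 sq.
- by apply: continuous_subspaceT => t; exact: sqrt_continuous.
- apply/andP; split.
    by apply: spec_ge Tt => x; have := bnd x; rewrite mulNr ler_norml => /andP[].
  by apply: spec_le Tt => x; have := bnd x; rewrite ler_norml => /andP[].
exact: is_cfc_cfc.
Qed.

Variables (J : set R) (m M : R).
Hypotheses (Ji : is_interval J) (Jm : J m) (JM : J M) (mM : m < M).

Lemma affine_cfc k c T : is_cfc (fun t => k * t + c) T (k%:C *: T + op_scalar c).
Proof.
have := is_cfc_horner (k *: 'X + c%:P) T.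
rewrite op_hornerD op_hornerZ op_hornerX op_hornerC; congr is_cfc.
by apply/funext => t; rewrite !hornerE.
Qed.

Lemma op_chord_le_outside f T S : convex_function (J : set R^o) f ->
  selfadjoint T -> is_cfc f T S ->
  (forall t, spectrum T t%:C -> J t /\ (t <= m \/ M <= t)) ->
  op_ge0 (S - (chord_slope f m M)%:C *: T - op_scalar (chord_const f m M)).
Proof.
move=> fconv sT fS out; rewrite -addrA -opprD.
apply: is_cfc_ge0 x00 sT (is_cfcD fS (is_cfcN (affine_cfc _ _ T))) _ => t /out[Jt tmM].
by rewrite subr_ge0; apply: chord_le_outside Jm JM mM t Jt tmM.
Qed.

Section Inside.
Variables (T : bop H).
Hypotheses (sT : selfadjoint T) (Tspec : forall t, spectrum T t%:C -> m <= t <= M).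
Let U := op_abs (T - op_scalar ((m + M) / 2)).

Lemma tent_cfc : is_cfc (fun t => 1 / 2 - (M - m)^-1 * `|t - (m + M) / 2|) T
  (op_scalar (1 / 2) - (M - m)^-1%:C *: U).
Proof.
have := is_cfcD (affine_cfc 0 (1 / 2) T) (is_cfcZ (- (M - m)^-1) (op_abs_cfc ((m + M) / 2) sT)).
rewrite scale0r add0r rmorphN scaleNr; congr is_cfc.
by apply/funext => t; rewrite mul0r add0r mulNr.
Qed.

Lemma tent_ge0 : op_ge0 (op_scalar (1 / 2) - (M - m)^-1%:C *: U).
Proof.
apply: is_cfc_ge0 x00 sT tent_cfc _ => t /Tspec /andP[mt tM].
rewrite subr_ge0 mulrC ler_pdivrMr ?subr_gt0// ler_norml; apply/andP; split; lra.
Qed.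

Lemma op_refined_chord f S : convex_function (J : set R^o) f -> is_cfc f T S ->
  op_ge0 ((chord_slope f m M)%:C *: T + op_scalar (chord_const f m M)
    - (delta_f f m M)%:C *: (op_scalar (1 / 2) - (M - m)^-1%:C *: U) - S).
Proof.
move=> fconv fS.
apply: is_cfc_ge0 x00 sT (is_cfcD (is_cfcD (affine_cfc _ _ T)
  (is_cfcN (is_cfcZ (delta_f f m M) tent_cfc))) (is_cfcN fS)) _ => t /Tspec tmM.
by rewrite subr_ge0; apply: (refined_chord fconv Ji Jm JM mM tmM).
Qed.

End Inside.

(** [X_tilde] is a sum of one tent function of [T] and one of [S], each of which
    is nonnegative when the spectrum is within [[m, M]]. *)
Lemma X_tildeE (S T : bop H) : X_tilde m M S T =
  (op_scalar (1 / 2) - (M - m)^-1%:C *: op_abs (T - op_scalar ((m + M) / 2))) +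
  (op_scalar (1 / 2) - (M - m)^-1%:C *: op_abs (S - op_scalar ((m + M) / 2))).
Proof.
rewrite [RHS]addrC /X_tilde /op_rscale addrACA -opprD [in LHS]scalerDr; congr (_ - _).
by rewrite /op_scalar -scalerDl -rmorphD -splitr scale1r.
Qed.

(** Adding the bounds below the average of [f] over the outer operators and the
    bounds above [f] at the inner ones, the affine terms cancel by [bal]. *)
Lemma two_averages_inequality (f : R -> R) (EA ED CC BB EfA EfD SC SB : bop H) :
  convex_function (J : set R^o) f -> EA + ED = CC + BB ->
  selfadjoint CC -> (forall t, spectrum CC t%:C -> m <= t <= M) ->
  selfadjoint BB -> (forall t, spectrum BB t%:C -> m <= t <= M) ->
  op_ge0 (EfA - (chord_slope f m M)%:C *: EA - op_scalar (chord_const f m M)) ->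
  op_ge0 (EfD - (chord_slope f m M)%:C *: ED - op_scalar (chord_const f m M)) ->
  is_cfc f CC SC -> is_cfc f BB SB ->
  let refined := EfA + EfD - delta_f f m M *op X_tilde m M BB CC in
  SC + SB <=op refined /\ refined <=op EfA + EfD.
Proof.
move=> fconv bal sC Cs sB Bs hA hD fC fB refined; split; last first.
  rewrite /op_le /refined opprB addrC subrK /op_rscale X_tildeE.
  apply: op_ge0Z; first exact: delta_f_ge0 fconv _ _ _ _ mM.
  by apply: op_ge0D; apply: tent_ge0.
have hC := op_refined_chord sC Cs fconv fC; have hB := op_refined_chord sB Bs fconv fB.
have := op_ge0D (op_ge0D hA hD) (op_ge0D hC hB).
have kbal : (chord_slope f m M)%:C *: EA + (chord_slope f m M)%:C *: ED =
    (chord_slope f m M)%:C *: CC + (chord_slope f m M)%:C *: BB.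
  by rewrite -!scalerDr bal.
by rewrite (sum_four_cancel _ _ _ _ _ _ _ kbal) -scalerDr -X_tildeE.
Qed.
End OperatorInequalities.

(** * The Mercer-type inequality *)

Section Between.
Variables (R : realType) (H : hilbertType R).
Implicit Types (T : bop H).

Lemma between_selfadjoint (m : R) T : op_scalar m <=op T -> selfadjoint T.
Proof.
move=> /op_ge0_selfadjoint sT; rewrite -[T](subrK (op_scalar m)).
by apply: selfadjointD => //; apply: selfadjoint_scalar.
Qed.

Lemma between_spectrum (m M : R) T : op_scalar m <=op T -> T <=op op_scalar M ->
  forall t, spectrum T t%:C -> m <= t <= M.
Proof.
move=> /op_ge_scalarP mT /op_le_scalarP TM t Tt.
by rewrite (spec_ge mT Tt) (spec_le TM Tt).
Qed.

Lemma between_selfadjoint_in (J : set R) (m M : R) T : is_interval J -> J m -> J M ->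
  op_scalar m <=op T -> T <=op op_scalar M -> selfadjoint_in J T.
Proof.
move=> Ji Jm JM mT TM; have sT := between_selfadjoint mT; split=> // z Tz.
exists (complex.Re z); last by rewrite -(spec_real sT Tz).
by apply: (Ji _ _ Jm JM); apply: (between_spectrum mT TM); rewrite -(spec_real sT Tz).
Qed.

End Between.

Theorem theorem2p2 (R : realType) (H : hilbertType R) (n1 n2 n3 n4 : nat)
    (Phi : 'I_n1 -> {linear bop H -> bop H})
    (Phib : 'I_n2 -> {linear bop H -> bop H})
    (Psi : 'I_n3 -> {linear bop H -> bop H})
    (Psib : 'I_n4 -> {linear bop H -> bop H})
    (Phi_pos : forall i, positive_map (Phi i))
    (Phib_pos : forall i, positive_map (Phib i))
    (Psi_pos : forall i, positive_map (Psi i))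
    (Psib_pos : forall i, positive_map (Psib i))
    (alpha beta gamma delta : R)
    (alpha_gt0 : 0 < alpha) (beta_gt0 : 0 < beta)
    (gamma_gt0 : 0 < gamma) (delta_gt0 : 0 < delta)
    (sum_Phi : \sum_i Phi i 1 = op_scalar alpha)
    (sum_Phib : \sum_i Phib i 1 = op_scalar delta)
    (sum_Psi : \sum_i Psi i 1 = op_scalar gamma)
    (sum_Psib : \sum_i Psib i 1 = op_scalar beta)
    (J : set R) (J_itv : is_interval J)
    (A : 'I_n1 -> bop H) (D : 'I_n2 -> bop H)
    (C : 'I_n3 -> bop H) (B : 'I_n4 -> bop H)
    (A_J : forall i, selfadjoint_in J (A i))
    (D_J : forall i, selfadjoint_in J (D i))
    (C_J : forall i, selfadjoint_in J (C i))
    (B_J : forall i, selfadjoint_in J (B i))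
    (m M : R) (m_lt_M : m < M)
    (A_le_m : forall i, A i <=op op_scalar m)
    (m_le_B : forall i, op_scalar m <=op B i)
    (m_le_C : forall i, op_scalar m <=op C i)
    (B_le_M : forall i, B i <=op op_scalar M)
    (M_le_D : forall i, op_scalar M <=op D i)
    (C_le_M : forall i, C i <=op op_scalar M)
    (balance : alpha^-1 *op (\sum_i Phi i (A i))
               + delta^-1 *op (\sum_i Phib i (D i))
             = gamma^-1 *op (\sum_i Psi i (C i))
               + beta^-1 *op (\sum_i Psib i (B i)))
    (f : R -> R) (f_cont : {within J, continuous f}) :
  let CC := gamma^-1 *op (\sum_i Psi i (C i)) in
  let BB := beta^-1 *op (\sum_i Psib i (B i)) in
  let lower := cfc f CC + cfc f BB in
  let upper := alpha^-1 *op (\sum_i Phi i (cfc f (A i)))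
               + delta^-1 *op (\sum_i Phib i (cfc f (D i))) in
  let refined := upper - delta_f f m M *op X_tilde m M BB CC in
  (convex_function (J : set R^o) f ->
     lower <=op refined /\ refined <=op upper) /\
  (concave_function (J : set R^o) f ->
     refined <=op lower /\ upper <=op refined).
Proof.
have [[x0 x00]|triv] := pselect (exists x : H, x != 0); last first.
  have ge0 (T : bop H) : op_ge0 T.
    move=> x; have -> : x = 0.
      by apply/eqP; apply: contrapT => /negP x0; apply: triv; exists x.
    by rewrite linear0r.
  by move=> CC BB lower upper refined; split=> _; split; apply: ge0.
(* [J] contains points [a <= m] and [b >= M]: spectra are nonempty,
   and the families [A], [D] too, since [alpha] and [delta] are nonzero. *)
have [Jm JM] : J m /\ J M.
  have [i _] := avg_inhabited x00 alpha_gt0 sum_Phi.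
  have [j _] := avg_inhabited x00 delta_gt0 sum_Phib.
  have [sA AJ] := A_J i; have [sD DJ] := D_J j.
  have [a Aa _] := inf_spectrum x00 sA; have [b Db _] := inf_spectrum x00 sD.
  have Ja : J a by have [t Jt /complexI <-] := AJ _ Aa.
  have Jb : J b by have [t Jt /complexI <-] := DJ _ Db.
  have am := spec_le (op_le_scalarP (A_le_m i)) Aa.
  have Mb := spec_ge (op_ge_scalarP (M_le_D j)) Db.
  by split; apply: (J_itv _ _ Ja Jb); rewrite ?am ?Mb ?andbT ?(le_trans am (ltW m_lt_M)) //=
    (le_trans (ltW m_lt_M)).
move=> CC BB lower upper refined.
have mCC : op_scalar m <=op CC := avg_ge Psi_pos gamma_gt0 sum_Psi m_le_C.
have CCM : CC <=op op_scalar M := avg_le Psi_pos gamma_gt0 sum_Psi C_le_M.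
have mBB : op_scalar m <=op BB := avg_ge Psib_pos beta_gt0 sum_Psib m_le_B.
have BBM : BB <=op op_scalar M := avg_le Psib_pos beta_gt0 sum_Psib B_le_M.
have CJ := between_selfadjoint_in J_itv Jm JM mCC CCM.
have BJ := between_selfadjoint_in J_itv Jm JM mBB BBM.
pose SA i := cfc f (A i); pose SD i := cfc f (D i).
have fA i : is_cfc f (A i) (SA i) := cfc_spec x00 J_itv f_cont (A_J i).
have fD i : is_cfc f (D i) (SD i) := cfc_spec x00 J_itv f_cont (D_J i).
have fC := cfc_spec x00 J_itv f_cont CJ; have fB := cfc_spec x00 J_itv f_cont BJ.
have real_spec_J T t : selfadjoint_in J T -> spectrum T t%:C -> J t.
  by move=> [_ TJ] /TJ[s Js /complexI <-].
(* Stated for a general [g] in order to serve both [f] and [- f]. *)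
have main g (TA : 'I_n1 -> bop H) (TD : 'I_n2 -> bop H) TC TB :
    convex_function (J : set R^o) g -> (forall i, is_cfc g (A i) (TA i)) ->
    (forall i, is_cfc g (D i) (TD i)) -> is_cfc g CC TC -> is_cfc g BB TB ->
    let up := avg Phi alpha TA + avg Phib delta TD in
    let ref := up - delta_f g m M *op X_tilde m M BB CC in
    TC + TB <=op ref /\ ref <=op up.
  move=> gconv gA gD gC gB.
  have hA : op_ge0 (avg Phi alpha TA - (chord_slope g m M)%:C *: avg Phi alpha A -
      op_scalar (chord_const g m M)).
    rewrite -(avg_scalar alpha_gt0 sum_Phi) -avgZ -!avgB; apply: avg_ge0 => // i.
    apply: (op_chord_le_outside x00 Jm JM m_lt_M gconv (A_J i).1 (gA i)) => t At.
    split; first exact: real_spec_J (A_J i) At.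
    by left; apply: spec_le At; apply: op_le_scalarP.
  have hD : op_ge0 (avg Phib delta TD - (chord_slope g m M)%:C *: avg Phib delta D -
      op_scalar (chord_const g m M)).
    rewrite -(avg_scalar delta_gt0 sum_Phib) -avgZ -!avgB; apply: avg_ge0 => // i.
    apply: (op_chord_le_outside x00 Jm JM m_lt_M gconv (D_J i).1 (gD i)) => t Dt.
    split; first exact: real_spec_J (D_J i) Dt.
    by right; apply: spec_ge Dt; apply: op_ge_scalarP.
  by apply: (two_averages_inequality x00 J_itv Jm JM m_lt_M gconv balance
    CJ.1 (between_spectrum mCC CCM)
    BJ.1 (between_spectrum mBB BBM) hA hD gC gB).
split=> [fconv|fconc]; first exact: main fconv fA fD fC fB.
(* In the concave case [- S] realizes [- f] whenever [S] realizes [f], and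
   [delta_f] changes sign with [f]. *)
have [] := main (fun t => - f t) _ _ _ _ fconc (fun i => is_cfcN (fA i))
  (fun i => is_cfcN (fD i)) (is_cfcN fC) (is_cfcN fB).
rewrite !avgN -!opprD.
have -> : delta_f (fun t => - f t) m M = - delta_f f m M by rewrite /delta_f; ring.
rewrite /op_le /op_rscale rmorphN scaleNr opprK !opprK.
rewrite /refined /upper /lower /op_rscale => h1 h2.
by split; rewrite addrC; [exact: h1|exact: h2].
Qed.
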